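(* Let $\Bbbk$ be a field, $F_1,\dots,F_s$ finite-dimensional skewfields over $\Bbbk$, $m_k,n_k$ non-negative integers with $(m_k,n_k)\ne(0,0)$ for $1\le k\le s$, and $\mathbb{M}=\prod_{k=1}^s\mathbb{M}(F_k,m_k,n_k)$. Let $(\mathfrak{M},\Omega)$ be the associated realization of a valued graph, and $\operatorname{Rep}(\mathfrak{M},\Omega)$ its category of representations (both described in the context). Let $\operatorname{Rep}^+(\mathfrak{M},\Omega)$ be the full subcategory of $\operatorname{Rep}(\mathfrak{M},\Omega)$ consisting of the representations such that $\sum_{l=1}^s\operatorname{Im}\tilde\beta_l=V_+$ and $\bigcap_{k,i}\operatorname{Ker}\alpha_{ki}=0$, where $\alpha_{ki}:V_-\to V_k$ are the components of $\tilde\alpha_k$. Let $\mathbb{M}\text{-}\mathrm{Mod}^+$ be the full subcategory of $\mathbb{M}\text{-}\mathrm{Mod}$ consisting of the modules $V$ such that $\sum_{l,j}\operatorname{Im}\beta_{lj}=\bigcap_{k,i}\operatorname{Ker}\alpha_{ki}$, where $\alpha_{ki}:V_0\to V_k$ and $\beta_{lj}:V_l\to V_0$ are the maps associated with $V$. Denote by $\mathcal{I}$ the ideal of the category $\mathbb{M}\text{-}\mathrm{Mod}^+$ consisting of all morphisms $\phi:V\to V'$ such that $\phi_k=0$ for $k\neq0$, $\phi_0(V_+)=0$ and $\operatorname{Im}\phi_0\subseteq V'_+$. Then there is an equivalence of categories $\mathbb{M}\text{-}\mathrm{Mod}^+/\mathcal{I}\simeq\operatorname{Rep}^+(\mathfrak{M},\Omega)$,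 and $\mathcal{I}^2=0$.
   Context: For a skewfield $F$, $\mathbb{M}(F,m,n)$ is the algebra of $(n+1)\times(m+1)$ matrices over $F$ with multiplication $a\cdot b=a\mu b$, where $\mu$ is the $(m+1)\times(n+1)$ matrix with $1$ at the $(1,1)$-place and $0$ elsewhere. $\mathbb{M}^1$ is $\mathbb{M}$ with a unit formally attached; $\mathbb{M}\text{-}\mathrm{Mod}$ is the category of left $\mathbb{M}$-modules ($\Bbbk$-spaces with $\Bbbk$-bilinear action), equivalently of unital $\mathbb{M}^1$-modules. Maps attached to a module: let $e_k\in\mathbb{M}(F_k,m_k,n_k)$ ($1\le k\le s$) be the idempotent given by the $(n_k+1)\times(m_k+1)$ matrix with $1$ at the $(1,1)$-place and $0$ elsewhere, and $e_0=1-\sum_{k=1}^se_k\in\mathbb{M}^1$. Then $e_k\mathbb{M}^1e_k=F_k$, $e_k\mathbb{M}^1e_0\simeq F_k^{m_k}$, $e_0\mathbb{M}^1e_k\simeq F_k^{n_k}$ for $k\neq0$. Choose an $F_k$-basis $a_{k1},\dots,a_{km_k}$ of $e_k\mathbb{M}^1e_0$ and an $F_k$-basis $b_{k1},\dots,b_{kn_k}$ of $e_0\mathbb{M}^1e_k$. For an $\mathbb{M}^1$-module $V$ put $V_k=e_kV$ ($0\le k\le s$), a vector space over $F_k$ (with $F_0=\Bbbk$). Multiplication by $a_{ki}$ gives a $\Bbbk$-linear map $\alpha_{ki}:V_0\to V_k$ and multiplication by $b_{kj}$ gives a $\Bbbk$-linear map $\beta_{kj}:V_k\to V_0$; they satisfy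 $\alpha_{ki}\beta_{lj}=0$ for all $k,l,i,j$. A homomorphism $\phi:V\to V'$ is the same as a family of $F_k$-linear maps $\phi_k:V_k\to V'_k$ ($0\le k\le s$) with $\phi_k\alpha_{ki}=\alpha'_{ki}\phi_0$ and $\phi_0\beta_{kj}=\beta'_{kj}\phi_k$. Put $V_+=\sum_{l,j}\operatorname{Im}\beta_{lj}\subseteq V_0$. Realization $(\mathfrak{M},\Omega)$: the graph has vertices $+,-,1,\dots,s$, with arrows $-\to k$ and $k\to+$; the modulation has skewfields $F_k$ at $k$ and $F_\pm=\Bbbk$ at $\pm$, $F_k$-$F_-$-bimodules ${}_kM_-=F_k^{m_k}$ and $F_+$-$F_k$-bimodules ${}_+M_k=F_k^{n_k}$. A representation consists of $F_k$-vector spaces $V_k$ ($1\le k\le s$), $\Bbbk$-vector spaces $V_+,V_-$, $F_k$-linear maps $\tilde\alpha_k:F_k^{m_k}\otimes_\Bbbk V_-\to V_k$ and $\Bbbk$-linear maps $\tilde\beta_k:F_k^{n_k}\otimes_{F_k}V_k=V_k^{n_k}\to V_+$. Equivalently, it is given by their components, arbitrary $\Bbbk$-linear maps $\alpha_{ki}:V_-\to V_k$ ($1\le i\le m_k$) and $\beta_{kj}:V_k\to V_+$ ($1\le j\le n_k$). Morphisms are families of ($F_k$-, resp. $\Bbbk$-) linear maps $V_k\to V'_k$, $V_\pm\to V'_\pm$ commuting with all these maps. *)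

(* Defs.v *)
From HB Require Import structures.
From mathcomp Require Import all_boot all_order all_algebra all_field.
From mathcomp Require Import boolp classical_sets.
Set Implicit Arguments.
Unset Strict Implicit.
Unset Printing Implicit Defensive.
Import GRing.Theory.
Local Open Scope ring_scope.
Local Open Scope quotient_scope.
Local Open Scope classical_set_scope.

Record category := Category {
  ob :> Type;
  hom : ob -> ob -> Type;
  idm : forall X, hom X X;
  comp : forall X Y Z, hom Y Z -> hom X Y -> hom X Z;
  compA : forall X Y Z T (h : hom Z T) (g : hom Y Z) (f : hom X Y),
    comp h (comp g f) = comp (comp h g) f;
  comp1m : forall X Y (f : hom X Y), comp (idm Y) f = f;
  compm1 : forall X Y (f : hom X Y), comp f (idm X) = f }.

Arguments idm {c} X.

Record functor (C D : category) := Functor {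
  fob :> C -> D;
  fmap : forall X Y, hom X Y -> hom (fob X) (fob Y);
  fmap1 : forall X, fmap (idm X) = idm (fob X);
  fmapM : forall X Y Z (g : hom Y Z) (f : hom X Y),
    fmap (comp g f) = comp (fmap g) (fmap f) }.

Definition id_functor (C : category) : functor C C :=
  @Functor C C id (fun _ _ => id) (fun _ => erefl) (fun _ _ _ _ _ => erefl).

Section FunctorComp.
Variables (C D E : category) (G : functor D E) (F : functor C D).

Lemma comp_fmap1 (X : C) : fmap G (fmap F (idm X)) = idm (G (F X)).
Proof. by rewrite !fmap1. Qed.

Lemma comp_fmapM (X Y Z : C) (g : hom Y Z) (f : hom X Y) :
  fmap G (fmap F (comp g f)) =
  comp (fmap G (fmap F g)) (fmap G (fmap F f)).
Proof. by rewrite !fmapM. Qed.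

Definition comp_functor : functor C E :=
  @Functor C E (fun X => G (F X)) (fun X Y f => fmap G (fmap F f))
    comp_fmap1 comp_fmapM.

End FunctorComp.

Definition nat_iso (C D : category) (F G : functor C D) : Prop :=
  exists (t : forall X, hom (F X) (G X)) (u : forall X, hom (G X) (F X)),
    [/\ forall X Y (f : hom X Y), comp (t Y) (fmap F f) = comp (fmap G f) (t X),
        forall X, comp (u X) (t X) = idm (F X)
      & forall X, comp (t X) (u X) = idm (G X)].

Definition equivalent (C D : category) : Prop :=
  exists (F : functor C D) (G : functor D C),
    nat_iso (comp_functor G F) (id_functor C) /\
    nat_iso (comp_functor F G) (id_functor D).

Definition full_sub (C : category) (P : C -> Prop) : category :=
  @Category {X : C | P X} (fun X Y => hom (sval X) (sval Y))
    (fun X => idm (sval X)) (fun X Y Z g f => comp g f)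
    (fun X Y Z T h g f => compA h g f)
    (fun X Y f => comp1m f) (fun X Y f => compm1 f).

Record preadditive := Preadditive {
  pob :> Type;
  phom : pob -> pob -> zmodType;
  pidm : forall X, phom X X;
  pcomp : forall X Y Z, phom Y Z -> phom X Y -> phom X Z;
  pcompA : forall X Y Z T (h : phom Z T) (g : phom Y Z) (f : phom X Y),
    pcomp h (pcomp g f) = pcomp (pcomp h g) f;
  pcomp1m : forall X Y (f : phom X Y), pcomp (pidm Y) f = f;
  pcompm1 : forall X Y (f : phom X Y), pcomp f (pidm X) = f;
  pcompDl : forall X Y Z (g h : phom Y Z) (f : phom X Y),
    pcomp (g + h) f = pcomp g f + pcomp h f;
  pcompDr : forall X Y Z (g : phom Y Z) (f h : phom X Y),
    pcomp g (f + h) = pcomp g f + pcomp g h }.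

Arguments pidm {p} X.

Definition full_psub (C : preadditive) (P : C -> Prop) : preadditive :=
  @Preadditive {X : C | P X} (fun X Y => phom (sval X) (sval Y))
    (fun X => pidm (sval X)) (fun X Y Z g f => pcomp g f)
    (fun X Y Z T h g f => pcompA h g f)
    (fun X Y f => pcomp1m f) (fun X Y f => pcompm1 f)
    (fun X Y Z g h f => pcompDl g h f) (fun X Y Z g f h => pcompDr g f h).

Record ideal (C : preadditive) := Ideal {
  ideal_pred : forall X Y : C, zmodClosed (phom X Y);
  ideal_compl : forall (X Y Z : C) (g : phom Y Z) (f : phom X Y),
    f \in ideal_pred X Y -> pcomp g f \in ideal_pred X Z;
  ideal_compr : forall (X Y Z : C) (g : phom Y Z) (f : phom X Y),
    g \in ideal_pred Y Z -> pcomp g f \in ideal_pred X Z }.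

Definition ideal_mul (C : preadditive) (I J : ideal C) (X Y : C)
    (f : phom X Y) : Prop :=
  exists (r : nat) (Z : 'I_r -> C)
         (g : forall i, phom (Z i) Y) (h : forall i, phom X (Z i)),
    (forall i, g i \in ideal_pred I (Z i) Y /\ h i \in ideal_pred J X (Z i)) /\
    f = \sum_(i < r) pcomp (g i) (h i).

Section QuotientCategory.
Variables (C : preadditive) (I : ideal C).

Definition qhom (X Y : C) : Type := {ideal_quot ideal_pred I X Y}.

Definition qcomp (X Y Z : C) (g : qhom Y Z) (f : qhom X Y) : qhom X Z :=
  \pi_{ideal_quot ideal_pred I X Z} (pcomp (repr g) (repr f)).

Lemma qhom_eqP (X Y : C) (f g : phom X Y) :
  reflect (\pi_{ideal_quot ideal_pred I X Y} f =
           \pi_{ideal_quot ideal_pred I X Y} g)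
          (f - g \in ideal_pred I X Y).
Proof. rewrite Quotient.idealrBE; apply: (iffP eqP) => h; exact: h. Qed.

Lemma pcompBl (X Y Z : C) (g h : phom Y Z) (f : phom X Y) :
  pcomp (g - h) f = pcomp g f - pcomp h f.
Proof. by apply/(canRL (addrK _)); rewrite -pcompDl subrK. Qed.

Lemma pcompBr (X Y Z : C) (g : phom Y Z) (f h : phom X Y) :
  pcomp g (f - h) = pcomp g f - pcomp g h.
Proof. by apply/(canRL (addrK _)); rewrite -pcompDr subrK. Qed.

Lemma repr_pi (X Y : C) (f : phom X Y) :
  repr (\pi_{ideal_quot ideal_pred I X Y} f) - f \in ideal_pred I X Y.
Proof. by apply/qhom_eqP; rewrite reprK. Qed.

Lemma qcompE (X Y Z : C) (g : phom Y Z) (f : phom X Y) :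
  qcomp (\pi_{ideal_quot ideal_pred I Y Z} g)
        (\pi_{ideal_quot ideal_pred I X Y} f) =
  \pi_{ideal_quot ideal_pred I X Z} (pcomp g f).
Proof.
apply/qhom_eqP; set g' := repr _; set f' := repr _.
rewrite -(subrK (pcomp g' f) (pcomp g' f')) -pcompBr -addrA -pcompBl.
apply: rpredD.
  exact: ideal_compl (repr_pi f).
exact: ideal_compr (repr_pi g).
Qed.

Lemma qcompA (X Y Z T : C) (h : qhom Z T) (g : qhom Y Z) (f : qhom X Y) :
  qcomp h (qcomp g f) = qcomp (qcomp h g) f.
Proof.
rewrite -[h]reprK -[g]reprK -[f]reprK (qcompE (repr g) (repr f)).
by rewrite (qcompE (repr h) (repr g)) !(qcompE, pcompA).
Qed.

Lemma qcomp1m (X Y : C) (f : qhom X Y) :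
  qcomp (\pi_{ideal_quot ideal_pred I Y Y} (pidm Y)) f = f.
Proof. by rewrite -[f]reprK qcompE pcomp1m. Qed.

Lemma qcompm1 (X Y : C) (f : qhom X Y) :
  qcomp f (\pi_{ideal_quot ideal_pred I X X} (pidm X)) = f.
Proof. by rewrite -[f]reprK qcompE pcompm1. Qed.

Definition quotient_category : category :=
  @Category C qhom
    (fun X => \pi_{ideal_quot ideal_pred I X X} (pidm X)) qcomp
    qcompA qcomp1m qcompm1.

End QuotientCategory.

Section RestrictScalars.
Variables (K : fieldType) (F : algType K) (V : lmodType F).

Definition rscal : Type := V.

HB.instance Definition _ := GRing.Zmodule.on rscal.

Definition rscale (c : K) (v : rscal) : rscal := c%:A *: (v : V).

Lemma rscaleA c d v : rscale c (rscale d v) = rscale (c * d) v.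
Proof. by rewrite /rscale scalerA -in_algE -rmorphM. Qed.

Lemma rscale1 : left_id 1 rscale.
Proof. by move=> v; rewrite /rscale !scale1r. Qed.

Lemma rscaleDr : right_distributive rscale +%R.
Proof. by move=> c v w; rewrite /rscale scalerDr. Qed.

Lemma rscaleDl v : {morph rscale^~ v : c d / c + d}.
Proof. by move=> c d; rewrite /rscale !scalerDl. Qed.

HB.instance Definition _ :=
  GRing.Zmodule_isLmodule.Build K rscal rscaleA rscale1 rscaleDr rscaleDl.

Lemma rscalE (c : K) (v : rscal) : c *: v = (c%:A : F) *: (v : V) :> V.
Proof. by []. Qed.

End RestrictScalars.

Section MunnAlgebra.
Variables (K : fieldType) (s : nat) (F : 'I_s -> falgType K).
Variables (m n : 'I_s -> nat).

Definition munn_block (k : 'I_s) : Type := 'M[F k]_((n k).+1, (m k).+1).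

HB.instance Definition _ k := GRing.Zmodule.on (munn_block k).
HB.instance Definition _ k :=
  GRing.Lmodule.copy (munn_block k)
    (rscal (F := F k) 'M[F k]_((n k).+1, (m k).+1)).

Definition munn : Type := forall k, munn_block k.

HB.instance Definition _ := gen_eqMixin munn.
HB.instance Definition _ := gen_choiceMixin munn.

Lemma munnP (x y : munn) : (forall k, x k = y k) -> x = y.
Proof. exact: functional_extensionality_dep. Qed.

Definition munn_add (x y : munn) : munn := fun k => x k + y k.
Definition munn_opp (x : munn) : munn := fun k => - x k.
Definition munn_scale (c : K) (x : munn) : munn := fun k => c *: x k.

Lemma munn_addA : associative munn_add.
Proof. by move=> x y z; apply: munnP => k; exact: addrA. Qed.
Lemma munn_addC : commutative munn_add.
Proof. by move=> x y; apply: munnP => k; exact: addrC. Qed.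
Lemma munn_add0 : left_id (fun k => 0 : munn_block k) munn_add.
Proof. by move=> x; apply: munnP => k; exact: add0r. Qed.
Lemma munn_addN : left_inverse (fun k => 0 : munn_block k) munn_opp munn_add.
Proof. by move=> x; apply: munnP => k; exact: addNr. Qed.

HB.instance Definition _ :=
  GRing.isZmodule.Build munn munn_addA munn_addC munn_add0 munn_addN.

Lemma munn_scaleA c d x : munn_scale c (munn_scale d x) = munn_scale (c * d) x.
Proof. by apply: munnP => k; exact: scalerA. Qed.
Lemma munn_scale1 : left_id 1 munn_scale.
Proof. by move=> x; apply: munnP => k; exact: scale1r. Qed.
Lemma munn_scaleDr : right_distributive munn_scale +%R.
Proof. by move=> c x y; apply: munnP => k; exact: scalerDr. Qed.
Lemma munn_scaleDl x : {morph munn_scale^~ x : c d / c + d}.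
Proof. by move=> c d; apply: munnP => k; exact: scalerDl. Qed.

HB.instance Definition _ :=
  GRing.Zmodule_isLmodule.Build K munn
    munn_scaleA munn_scale1 munn_scaleDr munn_scaleDl.

Definition munn_mu (k : 'I_s) : 'M[F k]_((m k).+1, (n k).+1) := delta_mx 0 0.

Definition munn_mul (x y : munn) : munn := fun k => x k *m munn_mu k *m y k.

Lemma munn_mulA : associative munn_mul.
Proof. by move=> x y z; apply: munnP => k; rewrite /munn_mul !mulmxA. Qed.

Lemma munn_mulDl : left_distributive munn_mul +%R.
Proof. by move=> x y z; apply: munnP => k; rewrite /munn_mul !mulmxDl. Qed.

Lemma munn_mulDr : right_distributive munn_mul +%R.
Proof. by move=> x y z; apply: munnP => k; rewrite /munn_mul mulmxDr. Qed.

Lemma munn_scaleAl c x y : munn_mul (c *: x) y = c *: munn_mul x y.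
Proof.
apply: munnP => k; rewrite /munn_mul.
by rewrite [(c *: x) k]rscalE [RHS]rscalE !scalemxAl.
Qed.

Lemma munn_scaleAr c x y : munn_mul x (c *: y) = c *: munn_mul x y.
Proof.
apply: munnP => k; rewrite /munn_mul.
rewrite [(c *: y) k]rscalE [RHS]rscalE; apply/matrixP => i j; rewrite !mxE.
rewrite big_distrr /=; apply: eq_bigr => l _; rewrite !mxE.
by rewrite !mulr_algl scalerAr.
Qed.

(* M^1: the pair (c, x) stands for c + x. *)
Definition munn1 : Type := (K * munn)%type.

HB.instance Definition _ := GRing.Lmodule.copy munn1 (K^o * munn)%type.

Definition munn1_one : munn1 := (1, 0).
Definition munn1_mul (x y : munn1) : munn1 :=
  (x.1 * y.1, x.1 *: y.2 + y.1 *: x.2 + munn_mul x.2 y.2).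

Lemma munn_mul0l x : munn_mul 0 x = 0.
Proof. by rewrite -[0 in LHS](scale0r (0 : munn)) munn_scaleAl scale0r. Qed.
Lemma munn_mul0r x : munn_mul x 0 = 0.
Proof. by rewrite -[0 in LHS](scale0r (0 : munn)) munn_scaleAr scale0r. Qed.

Lemma munn1_mulA : associative munn1_mul.
Proof.
move=> [c x] [d y] [e z]; congr (_, _) => /=; first by rewrite mulrA.
rewrite !munn_mulDl !munn_mulDr !scalerDr !munn_scaleAl !munn_scaleAr.
rewrite !scalerA munn_mulA [d * e]mulrC [e * c]mulrC [e * d]mulrC !addrA.
by rewrite [LHS](ACl (1*2*4*6*3*5*7)).
Qed.

Lemma munn1_mul1l : left_id munn1_one munn1_mul.
Proof.
move=> [c x]; rewrite /munn1_mul /= mul1r munn_mul0l scale1r scaler0.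
by rewrite !addr0.
Qed.

Lemma munn1_mul1r : right_id munn1_one munn1_mul.
Proof.
move=> [c x]; rewrite /munn1_mul /= mulr1 munn_mul0r scale1r scaler0.
by rewrite add0r addr0.
Qed.

Lemma munn1_mulDl : left_distributive munn1_mul +%R.
Proof.
move=> [c x] [d y] [e z]; congr (_, _) => /=; first by rewrite mulrDl.
rewrite scalerDl scalerDr munn_mulDl !addrA.
by rewrite [LHS](ACl (1*3*5*2*4*6)).
Qed.

Lemma munn1_mulDr : right_distributive munn1_mul +%R.
Proof.
move=> [c x] [d y] [e z]; congr (_, _) => /=; first by rewrite mulrDr.
rewrite scalerDl scalerDr munn_mulDr !addrA.
by rewrite [LHS](ACl (1*3*5*2*4*6)).
Qed.

HB.instance Definition _ :=
  GRing.Zmodule_isPzRing.Build munn1 munn1_mulA munn1_mul1l munn1_mul1r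
    munn1_mulDl munn1_mulDr.

(* The embedding F_k = e_k M^1 e_k -> M^1, f |-> f e_k. *)
Definition munnF (k : 'I_s) (f : F k) : munn1 :=
  (0, eqtype.dfwith (0 : munn)
        (f *: (delta_mx 0 0 : 'M[F k]_((n k).+1, (m k).+1)) : munn_block k)).

Definition munn_e (k : 'I_s) : munn1 := munnF (1 : F k).
Definition munn_e0 : munn1 := 1 - \sum_k munn_e k.

Definition is_left_basis (k : 'I_s) (a : 'I_(m k) -> munn1) : Prop :=
  let P := [set munn_e k * x * munn_e0 | x in setT] in
  (forall i, P (a i)) /\
  forall x, P x -> exists! c : {ffun 'I_(m k) -> F k},
    x = \sum_i munnF (c i) * a i.

Definition is_right_basis (k : 'I_s) (b : 'I_(n k) -> munn1) : Prop :=
  let P := [set munn_e0 * x * munn_e k | x in setT] in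
  (forall j, P (b j)) /\
  forall x, P x -> exists! c : {ffun 'I_(n k) -> F k},
    x = \sum_j b j * munnF (c j).

Record munn_module := MunnModule {
  mm_sort :> lmodType K;
  mm_act : {bilinear munn -> mm_sort -> mm_sort};
  mm_actA : forall x y v, mm_act (munn_mul x y) v = mm_act x (mm_act y v) }.

Definition is_munn_hom (V W : munn_module) (f : V -> W) : Prop :=
  linear f /\ forall x v, f (mm_act V x v) = mm_act W x (f v).

Record munn_hom (V W : munn_module) := MunnHom {
  munn_fun :> V -> W;
  munn_homP : is_munn_hom munn_fun }.

Lemma munn_hom_eq (V W : munn_module) (f g : munn_hom V W) : f =1 g -> f = g.
Proof.
case: f g => [f fP] [g gP] /= /funext fg; rewrite fg in fP *.
by rewrite (Prop_irrelevance fP gP).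
Qed.

Section MunnHomZmod.
Variables V W : munn_module.

HB.instance Definition _ := gen_eqMixin (munn_hom V W).
HB.instance Definition _ := gen_choiceMixin (munn_hom V W).

Lemma is_munn_hom0 : is_munn_hom (fun _ : V => 0 : W).
Proof. by split=> [c u v|x v]; rewrite ?linear0r // scaler0 addr0. Qed.
Lemma is_munn_homN (f : munn_hom V W) : is_munn_hom (fun v => - f v).
Proof.
case: f => f [fL fA]; split=> [c u v|x v] /=.
  by rewrite fL opprD scalerN.
by rewrite fA linearNr.
Qed.
Lemma is_munn_homD (f g : munn_hom V W) : is_munn_hom (fun v => f v + g v).
Proof.
case: f g => f [fL fA] [g [gL gA]]; split=> [c u v|x v] /=.
  by rewrite fL gL scalerDr addrACA.
by rewrite fA gA linearDr.
Qed.

Lemma munn_hom_addA : associative (fun f g => MunnHom (is_munn_homD f g)).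
Proof. by move=> f g h; apply: munn_hom_eq => v /=; rewrite addrA. Qed.
Lemma munn_hom_addC : commutative (fun f g => MunnHom (is_munn_homD f g)).
Proof. by move=> f g; apply: munn_hom_eq => v /=; rewrite addrC. Qed.
Lemma munn_hom_add0 :
  left_id (MunnHom is_munn_hom0) (fun f g => MunnHom (is_munn_homD f g)).
Proof. by move=> f; apply: munn_hom_eq => v /=; rewrite add0r. Qed.
Lemma munn_hom_addN :
  left_inverse (MunnHom is_munn_hom0) (fun f => MunnHom (is_munn_homN f))
    (fun f g => MunnHom (is_munn_homD f g)).
Proof. by move=> f; apply: munn_hom_eq => v /=; rewrite addNr. Qed.

HB.instance Definition _ :=
  GRing.isZmodule.Build (munn_hom V W) munn_hom_addA munn_hom_addC
    munn_hom_add0 munn_hom_addN.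

End MunnHomZmod.

Lemma munn_idP (V : munn_module) : is_munn_hom (@id V).
Proof. by []. Qed.

Lemma munn_compP (U V W : munn_module) (g : munn_hom V W) (f : munn_hom U V) :
  is_munn_hom (g \o f).
Proof.
case: g f => g [gL gA] [f [fL fA]]; split=> [c u v|x v] /=.
  by rewrite fL gL.
by rewrite fA gA.
Qed.

Definition munn_id V : munn_hom V V := MunnHom (munn_idP V).
Definition munn_comp U V W (g : munn_hom V W) (f : munn_hom U V) :
  munn_hom U W := MunnHom (munn_compP g f).

Lemma munn_compA U V W T (h : munn_hom W T) (g : munn_hom V W)
  (f : munn_hom U V) :
  munn_comp h (munn_comp g f) = munn_comp (munn_comp h g) f.
Proof. exact: munn_hom_eq. Qed.
Lemma munn_comp1m U V (f : munn_hom U V) : munn_comp (munn_id V) f = f.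
Proof. exact: munn_hom_eq. Qed.
Lemma munn_compm1 U V (f : munn_hom U V) : munn_comp f (munn_id U) = f.
Proof. exact: munn_hom_eq. Qed.
Lemma munn_compDl U V W (g h : munn_hom V W) (f : munn_hom U V) :
  munn_comp (g + h) f = munn_comp g f + munn_comp h f.
Proof. exact: munn_hom_eq. Qed.
Lemma munn_compDr U V W (g : munn_hom V W) (f h : munn_hom U V) :
  munn_comp g (f + h) = munn_comp g f + munn_comp g h.
Proof.
case: g => g [gL gA]; apply: munn_hom_eq => v /=.
by have := gL 1 (f v) (h v); rewrite !scale1r.
Qed.

Definition MunnMod : preadditive :=
  @Preadditive munn_module munn_hom munn_id munn_comp
    munn_compA munn_comp1m munn_compm1 munn_compDl munn_compDr.

Definition act1 (V : munn_module) (x : munn1) (v : V) : V :=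
  x.1 *: v + mm_act V x.2 v.

Definition mm_comp (V : munn_module) (k : 'I_s) : set V :=
  [set act1 (munn_e k) v | v in setT].
Definition mm_comp0 (V : munn_module) : set V :=
  [set act1 munn_e0 v | v in setT].

Variables (a : forall k, 'I_(m k) -> munn1) (b : forall k, 'I_(n k) -> munn1).

(* alpha_ki is meant as a map V_0 -> V_k and beta_kj as a map V_k -> V_0; here
   both are given on the whole of V. *)
Definition mm_alpha (V : munn_module) k (i : 'I_(m k)) (v : V) : V :=
  act1 (a i) v.
Definition mm_beta (V : munn_module) k (j : 'I_(n k)) (v : V) : V :=
  act1 (b j) v.

Definition mm_ker (V : munn_module) : set V :=
  [set v | mm_comp0 v /\ forall k (i : 'I_(m k)), mm_alpha i v = 0].

Definition mm_plus (V : munn_module) : set V :=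
  [set v | exists w : forall l, 'I_(n l) -> V,
     (forall l j, mm_comp l (w l j)) /\
     v = \sum_l \sum_j mm_beta j (w l j)].

Definition MunnModPlus : preadditive :=
  full_psub (C := MunnMod) (fun V : munn_module => @mm_plus V = @mm_ker V).

Definition in_munn_ideal (V W : munn_module) (f : munn_hom V W) : Prop :=
  [/\ forall k v, mm_comp k v -> f v = 0,
      forall v, mm_plus v -> f v = 0
    & forall v, mm_comp0 v -> mm_plus (f v)].

Section IdealPred.
Variables V W : munn_module.

Definition munn_ideal_pred : {pred munn_hom V W} :=
  fun f => `[< in_munn_ideal f >].

Lemma act1D (U : munn_module) x (u v : U) :
  act1 x (u + v) = act1 x u + act1 x v.
Proof. by rewrite /act1 scalerDr linearDr addrACA. Qed.

Lemma act10 (U : munn_module) x : act1 x (0 : U) = 0.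
Proof. by rewrite /act1 scaler0 linear0r addr0. Qed.

Lemma act1N (U : munn_module) x (u : U) : act1 x (- u) = - act1 x u.
Proof. by rewrite /act1 scalerN linearNr opprD. Qed.

Lemma mm_plus0 (U : munn_module) : mm_plus (0 : U).
Proof.
exists (fun _ _ => 0); split=> [l j|]; first by exists 0 => //; exact: act10.
by rewrite big1 // => l _; rewrite big1 // => j _; exact: act10.
Qed.

Lemma mm_plusB (U : munn_module) (u v : U) :
  mm_plus u -> mm_plus v -> mm_plus (u - v).
Proof.
move=> [w [wV ->]] [z [zV ->]]; exists (fun l j => w l j - z l j).
split=> [l j|].
  case: (wV l j) => w' _ <-; case: (zV l j) => z' _ <-.
  by exists (w' - z') => //; rewrite act1D act1N.
rewrite -sumrB; apply: eq_bigr => l _; rewrite -sumrB; apply: eq_bigr => j _.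
by rewrite /mm_beta act1D act1N.
Qed.

Lemma munn_ideal_zmod : zmod_closed munn_ideal_pred.
Proof.
split=> [|f g]; first by apply/asboolP; split=> // v _; exact: mm_plus0.
move=> /asboolP[f1 f2 f3] /asboolP[g1 g2 g3]; apply/asboolP; split.
- by move=> k v kv; rewrite /= (f1 k) // (g1 k) // subr0.
- by move=> v pv; rewrite /= f2 // g2 // subr0.
- by move=> v v0; apply: mm_plusB; [exact: f3|exact: g3].
Qed.

HB.instance Definition _ :=
  GRing.isZmodClosed.Build (munn_hom V W) munn_ideal_pred munn_ideal_zmod.

End IdealPred.

Lemma munn_hom_act1 (V W : munn_module) (f : munn_hom V W) x v :
  f (act1 x v) = act1 x (f v).
Proof.
case: f => f [fL fA] /=; rewrite /act1 fL; congr (_ + _).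
exact: fA.
Qed.

Lemma munn_hom_plus (V W : munn_module) (f : munn_hom V W) v :
  mm_plus v -> mm_plus (f v).
Proof.
have fD u w : f (u + w) = f u + f w.
  by case: f => f [fL _] /=; have := fL 1 u w; rewrite !scale1r.
have f0 : f 0 = 0 by apply: (addIr (f 0)); rewrite -fD !add0r.
move=> [w [wV ->]]; exists (fun l j => f (w l j)); split=> [l j|].
  by case: (wV l j) => w' _ <-; exists (f w') => //; rewrite munn_hom_act1.
rewrite (big_morph f fD f0); apply: eq_bigr => l _.
rewrite (big_morph f fD f0); apply: eq_bigr => j _.
exact: munn_hom_act1.
Qed.

Lemma munn_ideal_compl (U V W : munn_module) (g : munn_hom V W)
    (f : munn_hom U V) :
  f \in @munn_ideal_pred U V -> munn_comp g f \in @munn_ideal_pred U W.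
Proof.
have g0 : g 0 = 0.
  by have := munn_hom_act1 g 0 0; rewrite /act1 /= !scale0r !linear0l !addr0.
move=> /asboolP[f1 f2 f3]; apply/asboolP; split.
- by move=> k v kv; rewrite /= (f1 k).
- by move=> v pv; rewrite /= f2.
- by move=> v v0; exact: (munn_hom_plus g (f3 v v0)).
Qed.

Lemma munn_ideal_compr (U V W : munn_module) (g : munn_hom V W)
    (f : munn_hom U V) :
  g \in @munn_ideal_pred V W -> munn_comp g f \in @munn_ideal_pred U W.
Proof.
move=> /asboolP[g1 g2 g3]; apply/asboolP; split.
- by move=> k v [u _ <-]; apply: (g1 k); rewrite munn_hom_act1; exists (f u).
- by move=> v pv; apply: g2; exact: munn_hom_plus.
- by move=> v [u _ <-]; apply: g3; rewrite munn_hom_act1; exists (f u).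
Qed.

Definition munn_ideal : ideal MunnModPlus :=
  @Ideal MunnModPlus (fun X Y => @munn_ideal_pred (sval X) (sval Y))
    (fun X Y Z => @munn_ideal_compl (sval X) (sval Y) (sval Z))
    (fun X Y Z => @munn_ideal_compr (sval X) (sval Y) (sval Z)).

End MunnAlgebra.

Section Representations.
Variables (K : fieldType) (s : nat) (F : 'I_s -> falgType K).
Variables (m n : 'I_s -> nat).

(* An F_k-linear map F_k^m (x)_K V_- -> V_k is given by the corresponding map
   F_k^m x V_- -> V_k, F_k-linear in the first variable and K-linear in the
   second; F_k^n (x)_(F_k) V_k is taken to be V_k^n. *)
Record rep := Rep {
  rep_sort : forall k, lmodType (F k);
  rep_minus : lmodType K;
  rep_plus : lmodType K;
  rep_talpha : forall k, 'rV[F k]_(m k) -> rep_minus -> rep_sort k;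
  rep_talpha_linl : forall k v,
    linear (fun x : 'rV[F k]_(m k) => rep_talpha x v);
  rep_talpha_linr : forall k (x : 'rV[F k]_(m k)),
    linear (rep_talpha x : rep_minus -> rscal (rep_sort k));
  rep_tbeta : forall k,
    {linear {ffun 'I_(n k) -> rscal (rep_sort k)} -> rep_plus} }.

Definition rep_alpha (X : rep) k (i : 'I_(m k)) (v : rep_minus X) :
    rep_sort X k :=
  rep_talpha (delta_mx 0 i) v.

Definition is_rep_hom (X Y : rep) (fk : forall k, rep_sort X k -> rep_sort Y k)
    (fm : rep_minus X -> rep_minus Y) (fp : rep_plus X -> rep_plus Y) : Prop :=
  [/\ forall k, linear (fk k), linear fm, linear fp,
      forall k (x : 'rV[F k]_(m k)) v,
        fk k (rep_talpha x v) = rep_talpha x (fm v)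
    & forall k (w : {ffun 'I_(n k) -> rscal (rep_sort X k)}),
        fp (rep_tbeta X k w) = rep_tbeta Y k [ffun j => fk k (w j)]].

Record rep_hom (X Y : rep) := RepHom {
  rep_homk : forall k, rep_sort X k -> rep_sort Y k;
  rep_homm : rep_minus X -> rep_minus Y;
  rep_homp : rep_plus X -> rep_plus Y;
  rep_homP : is_rep_hom rep_homk rep_homm rep_homp }.

Arguments rep_homk {X Y} _ k _.

Lemma rep_hom_eq (X Y : rep) (f g : rep_hom X Y) :
  (forall k, rep_homk f k =1 rep_homk g k) -> rep_homm f =1 rep_homm g ->
  rep_homp f =1 rep_homp g -> f = g.
Proof.
case: f g => [fk fm fp fP] [gk gm gp gP] /= ek /funext em /funext ep.
have {}ek : fk = gk by apply: functional_extensionality_dep => k; exact/funext.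
by subst; rewrite (Prop_irrelevance fP gP).
Qed.

Lemma rep_idP (X : rep) : @is_rep_hom X X (fun k => id) id id.
Proof.
by split=> // k w; congr (rep_tbeta X k _); apply/ffunP => j; rewrite ffunE.
Qed.

Lemma rep_compP X Y Z (g : rep_hom Y Z) (f : rep_hom X Y) :
  is_rep_hom (fun k => rep_homk g k \o rep_homk f k)
    (rep_homm g \o rep_homm f) (rep_homp g \o rep_homp f).
Proof.
case: g f => [gk gm gp [gkL gmL gpL gA gB]] [fk fm fp [fkL fmL fpL fA fB]].
split=> [k c u v|c u v|c u v|k x v|k w] /=.
- by rewrite fkL gkL.
- by rewrite fmL gmL.
- by rewrite fpL gpL.
- by rewrite fA gA.
- rewrite fB gB; congr (rep_tbeta Z k _); apply/ffunP => j.
  by rewrite !ffunE.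
Qed.

Definition rep_id X : rep_hom X X := RepHom (rep_idP X).
Definition rep_comp X Y Z (g : rep_hom Y Z) (f : rep_hom X Y) : rep_hom X Z :=
  RepHom (rep_compP g f).

Lemma rep_compA X Y Z T (h : rep_hom Z T) (g : rep_hom Y Z) (f : rep_hom X Y) :
  rep_comp h (rep_comp g f) = rep_comp (rep_comp h g) f.
Proof. exact: rep_hom_eq. Qed.
Lemma rep_comp1m X Y (f : rep_hom X Y) : rep_comp (rep_id Y) f = f.
Proof. exact: rep_hom_eq. Qed.
Lemma rep_compm1 X Y (f : rep_hom X Y) : rep_comp f (rep_id X) = f.
Proof. exact: rep_hom_eq. Qed.

Definition RepCat : category :=
  @Category rep rep_hom rep_id rep_comp rep_compA rep_comp1m rep_compm1.

Definition RepPlus : category :=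
  full_sub (C := RepCat) (fun X : rep =>
    (forall v : rep_plus X,
       exists w : forall l, {ffun 'I_(n l) -> rscal (rep_sort X l)},
         v = \sum_l rep_tbeta X l (w l)) /\
    (forall v : rep_minus X,
       (forall k (i : 'I_(m k)), rep_alpha i v = 0) -> v = 0)).

End Representations.

(* Main.v *)
(* Let V be a module. The submodule killed by M lies in V_0 and equals the
   common kernel of the alpha_ki, so on M-Mod^+ it is V_+. Choosing a complement
   V_- of V_+ in V_0 (Zorn), the action is determined by the maps V_- -> V_k and
   V_k -> V_+; conversely a representation X in Rep^+ defines a module
   structure on X_+ (+) X_- (+) (+)_k X_k. This gives a dense functor from Rep^+
   to M-Mod^+ which becomes full and faithful modulo I: a homomorphism preserves
   each V_k, V_0 and V_+, so it is block triangular on V_0 = V_+ (+) V_-, and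
   I consists of the homomorphisms having only an off-diagonal block
   V_- -> V'_+. *)
From HB Require Import structures.
From mathcomp Require Import all_boot all_order all_algebra all_field.
From mathcomp Require Import boolp classical_sets.
Require Import Defs.

Set Implicit Arguments.
Unset Strict Implicit.
Unset Printing Implicit Defensive.
Import GRing.Theory.
Local Open Scope ring_scope.
Local Open Scope quotient_scope.
Local Open Scope classical_set_scope.

Local Notation "x ** v" := (mm_act _ x v) (at level 40, left associativity).

(** The complement V_- is not natural in V, so sending a module to its representation involves
    choices. Realizing a representation as a module involves none; hence the functor is built in
    that direction, and the complement is chosen for one module at a time, only to prove density.
    The quasi-inverse then comes from the general criterion for fully faithful dense functors. The
    bases a and b are arbitrary, but they enter only through [mm_ker] and [mm_plus]. [mm_kerE] and
    [mm_plusE] describe these sets without them, and everything else uses standard elements: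
    [munn_row y] (y placed in row 0 of a block) and [munn_col i] (the matrix unit E_i0). Since a mu
    b is the first column of a times the first row of b, every element of M is a sum of products
    E_i0 mu (row), so it acts by first mapping into some V_k and then applying E_i0. *)

Lemma equivalent_sym (C D : category) : equivalent C D -> equivalent D C.
Proof. by move=> [F [G [FG GF]]]; exists G, F. Qed.

Definition isomorphic (C : category) (X Y : C) : Prop :=
  exists (u : hom X Y) (v : hom Y X), comp v u = idm X /\ comp u v = idm Y.

(** * Fully faithful dense functors are equivalences *)

Section FullyFaithful.
Variables (C D : category) (F : functor C D).
Hypothesis full : forall (X Y : C) (g : hom (F X) (F Y)),
  exists f, fmap F f = g.
Hypothesis faithful : forall (X Y : C) (f g : hom X Y),
  fmap F f = fmap F g -> f = g.
Hypothesis dense : forall Y : D, exists X, isomorphic (F X) Y.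

Lemma fully_faithful_dense_equivalent : equivalent C D.
Proof.
have iso Y : {X : C & {u : hom (F X) Y & {v : hom Y (F X) |
    comp v u = idm _ /\ comp u v = idm _}}}.
  by have [X /cid[u /cid[v uv]]] := cid (dense Y); exists X, u, v.
pose Go Y := projT1 (iso Y); pose u Y := projT1 (projT2 (iso Y)).
pose v Y := sval (projT2 (projT2 (iso Y))).
have vu Y : comp (v Y) (u Y) = idm _ := (svalP (projT2 (projT2 (iso Y)))).1.
have uv Y : comp (u Y) (v Y) = idm _ := (svalP (projT2 (projT2 (iso Y)))).2.
have [lift liftE] : exists lift : forall X Y, hom (F X) (F Y) -> hom X Y,
    forall X Y g, fmap F (lift X Y g) = g.
  exists (fun X Y g => projT1 (cid (@full X Y g))) => X Y g.
  exact: projT2 (cid (@full X Y g)).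
(* Conjugation by the chosen isomorphisms gives a morphism between images of F, which is then
   lifted. Faithfulness reduces the identities for such lifts to identities in D. *)
pose Gm X Y (f : hom X Y) := lift _ _ (comp (v Y) (comp f (u X))).
have Gm1 X : Gm X X (idm X) = idm (Go X).
  by apply: faithful; rewrite liftE comp1m vu fmap1.
have GmM X Y Z (g : hom Y Z) (f : hom X Y) :
    Gm X Z (comp g f) = comp (Gm Y Z g) (Gm X Y f).
  apply: faithful; rewrite fmapM !liftE !compA; congr (comp (comp _ _) _).
  by rewrite -(compA _ (u Y)) uv compm1.
exists F, (Functor Gm1 GmM); split.
  exists (fun X => lift _ _ (u (F X))), (fun X => lift _ _ (v (F X))).
  split=> [X Y f|X|X]; apply: faithful; rewrite fmapM !liftE ?fmap1 //.
    by rewrite fmapM !liftE !compA uv comp1m.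
  exact: vu.
exists u, v; split=> [X Y f|X|X]; [|exact: vu|exact: uv].
by rewrite /= liftE !compA uv comp1m.
Qed.

End FullyFaithful.

(** * Linear algebra *)

Section LinearRetraction.
Variables (K : fieldType) (V : lmodType K) (S : set V).
Hypothesis S0 : S 0.
Hypothesis SP : forall c u v, S u -> S v -> S (c *: u + v).

Let stable (A : set V) := forall c u v, A u -> A v -> A (c *: u + v).

(* A maximal subspace meeting [S] trivially is a complement of [S]. *)
Let transverse (A : set V) :=
  stable A /\ forall v, A v -> S v -> v = 0.

Lemma exists_complement : exists A : set V,
  [/\ A 0, transverse A & forall v, exists2 u, S u & A (v - u)].
Proof.
have [B [[Bst B0] Bmax]] : exists A, transverse A /\
    forall B, A `<` B -> ~ transverse B.
  apply: Zorn_bigcup => FF FT Ftot; split=> [c u v|v] [X FX Xu].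
    move=> [Y FY Yv]; have [XY|YX] := Ftot _ _ FX FY.
      by exists Y => //; apply: (FT _ FY).1 => //; exact: XY.
    by exists X => //; apply: (FT _ FX).1 => //; exact: YX.
  exact: (FT _ FX).2.
(* The union of the empty chain is empty, so [transverse] cannot demand 0. The maximal B contains it
   all the same: otherwise B is empty and {0} is larger. *)
have Bz : B 0.
  apply: contrapT => nB0; apply: (Bmax [set 0]).
    split=> [v Bv|sub]; last by apply: nB0; exact: sub.
    by case: nB0; rewrite -(addNr v) -scaleN1r; exact: Bst.
  split=> [c u v -> ->|v -> //]; first by rewrite scaler0 addr0.
have BZ c v : B v -> B (c *: v).
  by move=> Bv; rewrite -[_ *: _]addr0; exact: Bst.
have SZ c v : S v -> S (c *: v).
  by move=> Sv; rewrite -[_ *: _]addr0; exact: SP.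
exists B; split=> // v; apply: contrapT => nv.
(* [B'] is B + Kv. If it contains w in S with coefficient c != 0, then v is the sum of w/c in S and
   an element of B, against the choice of v; so [B'] is again transverse, against maximality. *)
pose B' := [set w | exists c, B (w - c *: v)].
apply: (Bmax B').
  split=> [w Bw|sub]; first by exists 0; rewrite scale0r subr0.
  apply: nv; exists 0 => //; rewrite subr0; apply: sub.
  by exists 1; rewrite scale1r subrr.
split=> [c u w [d du] [e ew]|w [c Bw] Sw].
  exists (c * d + e); rewrite scalerDl -scalerA opprD addrACA -scalerN.
  rewrite -scalerDr.
  exact: Bst.
have [c0|c0] := eqVneq c 0.
  by apply: B0 => //; move: Bw; rewrite c0 scale0r subr0.
case: nv; exists (c^-1 *: w); first exact: SZ.
have := BZ (- c^-1) _ Bw; rewrite scalerBr scalerA mulNr mulVf // scaleN1r.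
by rewrite opprK scaleNr addrC.
Qed.

Lemma exists_linear_retraction : exists p : V -> V,
  [/\ linear p, forall v, S (p v) & forall v, S v -> p v = v].
Proof.
have [A [A0 [Ast AS0] Asum]] := exists_complement.
have {}Asum v : exists u, S u /\ A (v - u).
  by have [u Su Au] := Asum v; exists u.
have [p pP] := choice Asum.
(* The S-part of v is unique because S and A meet in 0. This is what makes the map obtained by
   choice linear. *)
have uniq v u : S u -> A (v - u) -> p v = u.
  move=> Su Au; have [Sp Ap] := pP v; apply/eqP; rewrite -subr_eq0; apply/eqP.
  apply: AS0; last by rewrite addrC -scaleN1r; exact: SP.
  have -> : p v - u = -1 *: (v - p v) + (v - u).
    by rewrite scaleN1r opprB addrA subrK.
  exact: Ast.
exists p; split=> [c u v|v|v Sv].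
- have [Su Au] := pP u; have [Sv Av] := pP v.
  apply: uniq; first exact: SP.
  by rewrite opprD addrACA -scalerN -scalerDr; exact: Ast.
- by case: (pP v).
- by apply: uniq => //; rewrite subrr.
Qed.

End LinearRetraction.

Section DependentProduct.
Variables (K : pzRingType) (I : Type) (T : I -> lmodType K).

(** Carries the sum of the spaces V_k, whose types vary with k; over the finite index set the
    product is the direct sum. *)
Definition depfun : Type := forall i, T i.

HB.instance Definition _ := gen_eqMixin depfun.
HB.instance Definition _ := gen_choiceMixin depfun.

Lemma depfunP (x y : depfun) : (forall i, x i = y i) -> x = y.
Proof. exact: functional_extensionality_dep. Qed.

Definition depfun_add (x y : depfun) : depfun := fun i => x i + y i.
Definition depfun_opp (x : depfun) : depfun := fun i => - x i.
Definition depfun_scale (c : K) (x : depfun) : depfun := fun i => c *: x i.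

Lemma depfun_addA : associative depfun_add.
Proof. by move=> x y z; apply: depfunP => i; exact: addrA. Qed.
Lemma depfun_addC : commutative depfun_add.
Proof. by move=> x y; apply: depfunP => i; exact: addrC. Qed.
Lemma depfun_add0 : left_id (fun i => 0 : T i) depfun_add.
Proof. by move=> x; apply: depfunP => i; exact: add0r. Qed.
Lemma depfun_addN : left_inverse (fun i => 0 : T i) depfun_opp depfun_add.
Proof. by move=> x; apply: depfunP => i; exact: addNr. Qed.

HB.instance Definition _ :=
  GRing.isZmodule.Build depfun depfun_addA depfun_addC depfun_add0 depfun_addN.

Lemma depfun_scaleA c d x :
  depfun_scale c (depfun_scale d x) = depfun_scale (c * d) x.
Proof. by apply: depfunP => i; exact: scalerA. Qed.
Lemma depfun_scale1 : left_id 1 depfun_scale.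
Proof. by move=> x; apply: depfunP => i; exact: scale1r. Qed.
Lemma depfun_scaleDr : right_distributive depfun_scale +%R.
Proof. by move=> c x y; apply: depfunP => i; exact: scalerDr. Qed.
Lemma depfun_scaleDl x : {morph depfun_scale^~ x : c d / c + d}.
Proof. by move=> c d; apply: depfunP => i; exact: scalerDl. Qed.

HB.instance Definition _ :=
  GRing.Zmodule_isLmodule.Build K depfun
    depfun_scaleA depfun_scale1 depfun_scaleDr depfun_scaleDl.

End DependentProduct.

Lemma linear_fun0 (R : pzRingType) (U V : lmodType R) (f : U -> V) :
  linear f -> f 0 = 0.
Proof. by move=> /zmod_morphism_linear/(_ 0 0); rewrite !subrr. Qed.

Lemma linear_fun_sum (R : pzRingType) (U V : lmodType R) (f : U -> V) I
    (r : seq I) (P : pred I) (E : I -> U) :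
  linear f -> f (\sum_(i <- r | P i) E i) = \sum_(i <- r | P i) f (E i).
Proof.
move=> fL; apply: (big_morph f) => [u v|]; last exact: linear_fun0.
by have := fL 1 u v; rewrite !scale1r.
Qed.

Definition row_tail (R : Type) q (y : 'rV[R]_q.+1) : 'rV[R]_q :=
  \row_j y 0 (lift ord0 j).

(** Entry 0 of a row is its coefficient at e_k. The rows with entry 0 equal to 0 are a copy of
    F_k^m, and they represent e_k M^1 e_0. *)
Definition row_cons (R : nmodType) q (r : 'rV[R]_q) : 'rV[R]_q.+1 :=
  \row_j oapp (r 0) 0 (unlift ord0 j).

Lemma row_cons0 (R : nmodType) q (r : 'rV[R]_q) : row_cons r 0 0 = 0.
Proof. by rewrite mxE unlift_none. Qed.

Lemma row_consK (R : nmodType) q : cancel (@row_cons R q) (@row_tail R q).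
Proof. by move=> r; apply/rowP => j; rewrite !mxE liftK. Qed.

Lemma row_cons_linear (R : pzRingType) q : linear (@row_cons R q).
Proof.
move=> c r z; apply/rowP => j; rewrite !mxE.
by case: unlift => [j'|] /=; rewrite ?mxE // mulr0 addr0.
Qed.

Lemma row_splitE (R : pzRingType) q (y : 'rV[R]_q.+1) :
  y = y 0 0 *: delta_mx 0 0 + row_cons (row_tail y).
Proof.
apply/rowP => j; rewrite !mxE; case: (unliftP ord0 j) => [j'|] ->.
  by rewrite /= mxE mulr0 add0r.
by rewrite /= mulr1 addr0.
Qed.

Lemma mx_sum_row (R : pzRingType) p q (A : 'M[R]_(p, q)) :
  A = \sum_i (delta_mx i 0 : 'cV_p) *m row i A.
Proof.
apply/matrixP => i j; rewrite summxE (bigD1 i) //= big1 => [|l /negPf li].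
  by rewrite !mxE big_ord1 !mxE !eqxx mul1r addr0.
by rewrite !mxE big_ord1 !mxE eq_sym li mul0r.
Qed.

(** * Calculations in the Munn algebra and its modules *)

Section MunnElements.
Variables (K : fieldType) (s : nat) (F : 'I_s -> falgType K).
Variables (m n : 'I_s -> nat).
Local Notation M := (munn F m n).
Local Notation M1 := (munn1 F m n).

Definition munn_in k (A : 'M[F k]_((n k).+1, (m k).+1)) : M :=
  eqtype.dfwith (0 : M) (A : munn_block F m n k).

Lemma munn_in_eq k (A : 'M[F k]_((n k).+1, (m k).+1)) : munn_in A k = A.
Proof. exact: dfwith_in. Qed.

Lemma munn_in_neq k l (A : 'M[F k]_((n k).+1, (m k).+1)) :
  k != l -> munn_in A l = 0.
Proof. exact: dfwith_out. Qed.

Lemma munnDE (x y : M) k : (x + y) k = x k + y k. Proof. by []. Qed.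
Lemma munn_sumE I (r : seq I) (P : pred I) (G : I -> M) k :
  (\sum_(i <- r | P i) G i) k = \sum_(i <- r | P i) G i k.
Proof. by elim/big_rec2: _ => // i x y _ <-. Qed.

Lemma munn_sum_in (x : M) : x = \sum_k munn_in (x k).
Proof.
apply: munnP => k; rewrite munn_sumE (bigD1 k) //= munn_in_eq big1 ?addr0 //.
by move=> l lk; rewrite munn_in_neq.
Qed.

Lemma munn_in_mul k (A B : 'M[F k]_((n k).+1, (m k).+1)) :
  munn_mul (munn_in A) (munn_in B) = munn_in (A *m munn_mu F m n k *m B).
Proof.
apply: munnP => l; rewrite /munn_mul; have [<-|kl] := eqVneq k l.
  by rewrite !munn_in_eq.
by rewrite !munn_in_neq // mulmx0.
Qed.

Lemma munn_in_mul_neq k l (A : 'M[F k]_((n k).+1, (m k).+1))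
    (B : 'M[F l]_((n l).+1, (m l).+1)) :
  k != l -> munn_mul (munn_in A) (munn_in B) = 0.
Proof.
move=> kl; apply: munnP => j; rewrite /munn_mul; have [kj|kj] := eqVneq k j.
  by rewrite -kj (munn_in_neq B) ?mulmx0 // eq_sym.
by rewrite (munn_in_neq A) // !mul0mx.
Qed.

Lemma munn_in0 k : munn_in (0 : 'M[F k]_((n k).+1, (m k).+1)) = 0.
Proof.
apply: munnP => l; have [<-|kl] := eqVneq k l; first by rewrite munn_in_eq.
by rewrite munn_in_neq.
Qed.

Lemma munn_inD k (A B : 'M[F k]_((n k).+1, (m k).+1)) :
  munn_in (A + B) = munn_in A + munn_in B.
Proof.
apply: munnP => l; rewrite munnDE; have [<-|kl] := eqVneq k l.
  by rewrite !munn_in_eq.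
by rewrite !munn_in_neq // addr0.
Qed.

(** These elements make up e_k M: entry 0 of y gives a multiple of e_k, the remaining entries an
    element of e_k M^1 e_0. *)
Definition munn_row k (y : 'rV[F k]_(m k).+1) : M :=
  munn_in ((delta_mx 0 0 : 'cV[F k]_(n k).+1) *m y).

(** The index 0 gives e_k; the positive indices give the standard basis of e_0 M^1 e_k. *)
Definition munn_col k (i : 'I_(n k).+1) : M := munn_in (delta_mx i 0).

Definition munn_idem k : M := munn_col (0 : 'I_(n k).+1).

(* [a mu b] only sees the first column of [a] and the first row of [b]. *)
Lemma mulmx_mu k (A B : 'M[F k]_((n k).+1, (m k).+1)) :
  A *m munn_mu F m n k *m B = col 0 A *m row 0 B.
Proof.
rewrite /munn_mu colE rowE -!mulmxA; congr (_ *m _); rewrite mulmxA.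
by rewrite mul_delta_mx.
Qed.

Lemma munn_mul_col_row k i (y : 'rV[F k]_(m k).+1) :
  munn_mul (munn_col i) (munn_row y) =
  munn_in ((delta_mx i 0 : 'cV[F k]_(n k).+1) *m y).
Proof.
rewrite munn_in_mul mulmx_mu; congr (munn_in (_ *m _)).
  by rewrite colE mul_delta_mx.
by rewrite rowE mulmxA mul_delta_mx -rowE row_id.
Qed.

Lemma munn_in_sum k I (r : seq I) (P : pred I)
    (A : I -> 'M[F k]_((n k).+1, (m k).+1)) :
  munn_in (\sum_(i <- r | P i) A i) = \sum_(i <- r | P i) munn_in (A i).
Proof. exact: (big_morph (@munn_in k) (@munn_inD k) (munn_in0 k)). Qed.

(** Each block is the sum of its rows, and multiplying by E_i0 on the left moves row 0 to row i. So
    the action of M is known once the rows and the E_i0 are known to act. *)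
Lemma munn_sum_col_row (x : M) :
  x = \sum_k \sum_i munn_mul (munn_col i) (munn_row (row i (x k))).
Proof.
rewrite [LHS]munn_sum_in; apply: eq_bigr => k _.
under eq_bigr do rewrite munn_mul_col_row.
by rewrite -munn_in_sum -mx_sum_row.
Qed.

Lemma munn_mul_row k (y : 'rV[F k]_(m k).+1) (x : M) :
  munn_mul (munn_row y) x = munn_row (y 0 0 *: row 0 (x k)).
Proof.
apply: munnP => l; have [<-|kl] := eqVneq k l; last first.
  by rewrite /munn_mul /munn_row !munn_in_neq // !mul0mx.
rewrite /munn_mul /munn_row !munn_in_eq mulmx_mu colE -!mulmxA; congr (_ *m _).
rewrite mulmxA -colE [col 0 y]mx11_scalar mul_scalar_mx mxE.
by [].
Qed.

Lemma munn_idemE k :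
  munn_idem k = munn_row (delta_mx 0 0 : 'rV[F k]_(m k).+1).
Proof. by rewrite /munn_row mul_delta_mx. Qed.

Lemma munn_rowD k (y z : 'rV[F k]_(m k).+1) :
  munn_row (y + z) = munn_row y + munn_row z.
Proof. by rewrite /munn_row mulmxDr munn_inD. Qed.

Lemma munn_row0 k : munn_row (0 : 'rV[F k]_(m k).+1) = 0.
Proof. by rewrite /munn_row mulmx0 munn_in0. Qed.

Lemma munn_rowZ k (c : K) (y : 'rV[F k]_(m k).+1) :
  munn_row (c%:A *: y) = c *: munn_row y.
Proof.
apply: munnP => l; rewrite /munn_row.
have -> (x : M) : (c *: x) l = c *: x l by [].
have [<-|kl] := eqVneq k l; last by rewrite !munn_in_neq // scaler0.
rewrite !munn_in_eq rscalE; apply/matrixP => i j; rewrite !mxE !big_ord1 !mxE.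
by rewrite !mulr_algl scalerAr.
Qed.

Lemma munn_mul_row_row k (y z : 'rV[F k]_(m k).+1) :
  munn_mul (munn_row y) (munn_row z) = munn_row (y 0 0 *: z).
Proof.
rewrite munn_mul_row [munn_row z k]munn_in_eq rowE mulmxA mul_delta_mx.
by rewrite -rowE row_id.
Qed.

Lemma munn_mul_row_row_neq k l (y : 'rV[F k]_(m k).+1) (z : 'rV[F l]_(m l).+1) :
  k != l -> munn_mul (munn_row y) (munn_row z) = 0.
Proof. exact: munn_in_mul_neq. Qed.

Lemma munn_mul_row_col k (y : 'rV[F k]_(m k).+1) (j : 'I_(n k)) :
  munn_mul (munn_row y) (munn_col (lift ord0 j)) = 0.
Proof.
rewrite munn_mul_row [munn_col _ k]munn_in_eq.
suff -> : row 0 (delta_mx (lift ord0 j) 0 : 'M[F k]_((n k).+1, (m k).+1)) = 0.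
  by rewrite scaler0 munn_row0.
by apply/rowP => i; rewrite !mxE.
Qed.

Lemma munnFE k (f : F k) :
  munnF m n f = (0, munn_row (f *: (delta_mx 0 0 : 'rV[F k]_(m k).+1))).
Proof.
congr (_, munn_in _); apply/matrixP => i j; rewrite !mxE big_ord1 !mxE.
by case: (i == 0); rewrite ?mul1r ?mul0r ?mulr0.
Qed.

Lemma munn_eE k : munn_e F m n k = (0, munn_idem k).
Proof. by rewrite /munn_e munnFE scale1r munn_idemE. Qed.

Lemma munn_id_row k (y : 'rV[F k]_(m k).+1) :
  munn_mul (munn_idem k) (munn_row y) = munn_row y.
Proof. by rewrite munn_idemE munn_mul_row_row mxE !eqxx scale1r. Qed.

End MunnElements.

(** * The components of a module, its kernel and V_+ *)

Section MunnModules.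
Variables (K : fieldType) (s : nat) (F : 'I_s -> falgType K).
Variables (m n : 'I_s -> nat).
Local Notation M := (munn F m n).
Local Notation M1 := (munn1 F m n).

(** The factor mu picks out row 0 of the right factor, and E_i0 with i > 0 has row 0 equal to zero.
    Consequently M kills the image of each such E_i0 in a module. *)
Lemma munn_mul_col_lift k (j : 'I_(n k)) (x : M) :
  munn_mul x (munn_col F m (lift ord0 j)) = 0.
Proof.
rewrite (munn_sum_in x); apply: munnP => l; rewrite /munn_mul munn_sumE.
rewrite (bigD1 l) //= big1 ?addr0 => [|l' ll]; last by rewrite munn_in_neq.
rewrite munn_in_eq /munn_col.
have [<-|kl] := eqVneq k l; last by rewrite munn_in_neq // mulmx0.
rewrite munn_in_eq mulmx_mu (_ : row 0 _ = 0) ?mulmx0 //.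
by apply/rowP => i; rewrite !mxE.
Qed.

Section OneModule.
Variable V : munn_module F m n.
Implicit Types (v w : V).

Lemma act1_munn (x : M) v : act1 (0, x) v = x ** v.
Proof. by rewrite /act1 scale0r add0r. Qed.

Lemma act1M (x y : M1) v : act1 (x * y) v = act1 x (act1 y v).
Proof.
case: x y => [c x] [d y]; rewrite /act1 /= !linearDl !linearZl /=.
by rewrite mm_actA !scalerDr scalerA linearDr linearZr /= !addrA.
Qed.

Lemma act1Dl (x y : M1) v : act1 (x + y) v = act1 x v + act1 y v.
Proof. by rewrite /act1 /= scalerDl linearDl addrACA. Qed.

Lemma act1Nl (x : M1) v : act1 (- x) v = - act1 x v.
Proof. by rewrite /act1 /= scaleNr linearNl opprD. Qed.

Lemma act1_0l v : act1 (0 : M1) v = 0.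
Proof. by rewrite /act1 scale0r linear0l addr0. Qed.

Lemma act1_suml I (r : seq I) (P : pred I) (G : I -> M1) v :
  act1 (\sum_(i <- r | P i) G i) v = \sum_(i <- r | P i) act1 (G i) v.
Proof.
exact: (big_morph (fun x => act1 x v) (fun x y => act1Dl x y v) (act1_0l v)).
Qed.

Lemma act1_sumr I (r : seq I) (P : pred I) (G : I -> V) (x : M1) :
  act1 x (\sum_(i <- r | P i) G i) = \sum_(i <- r | P i) act1 x (G i).
Proof. exact: (big_morph (act1 x) (act1D x) (act10 V x)). Qed.

Lemma act1_e0 v :
  act1 (munn_e0 F m n) v = v - \sum_k munn_idem F m n k ** v.
Proof.
rewrite /munn_e0 act1Dl [act1 1 v]/act1 scale1r linear0l addr0; congr (_ + _).
rewrite act1Nl act1_suml; congr (- _); apply: eq_bigr => k _.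
by rewrite munn_eE act1_munn.
Qed.

Lemma id_act_row k (y : 'rV[F k]_(m k).+1) v :
  munn_idem F m n k ** (munn_row n y ** v) = munn_row n y ** v.
Proof. by rewrite -mm_actA munn_id_row. Qed.

Lemma id_act_id k v :
  munn_idem F m n k ** (munn_idem F m n k ** v) = munn_idem F m n k ** v.
Proof. by rewrite [in RHS]munn_idemE -id_act_row -munn_idemE. Qed.

Lemma row_act_neq k l (y : 'rV[F k]_(m k).+1) v :
  k != l -> munn_row n y ** (munn_idem F m n l ** v) = 0.
Proof.
by move=> kl; rewrite munn_idemE -mm_actA munn_mul_row_row_neq // linear0l.
Qed.

Lemma row_act_id k (y : 'rV[F k]_(m k).+1) v :
  munn_row n y ** (munn_idem F m n k ** v) =
  munn_row n (y 0 0 *: delta_mx 0 0) ** v.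
Proof. by rewrite -mm_actA munn_idemE munn_mul_row_row. Qed.

Lemma mm_compE k v : mm_comp k v <-> munn_idem F m n k ** v = v.
Proof.
split=> [[w _ <-]|<-]; first by rewrite munn_eE act1_munn id_act_id.
by exists v => //; rewrite munn_eE act1_munn.
Qed.

Lemma id_act_e0 k v : munn_idem F m n k ** act1 (munn_e0 F m n) v = 0.
Proof.
rewrite act1_e0 linearBr linear_sumr (bigD1 k) //= id_act_id.
rewrite big1 ?addr0 ?subrr //.
by move=> l lk; rewrite [in X in X ** _]munn_idemE row_act_neq // eq_sym.
Qed.

Lemma mm_comp0E v : mm_comp0 v <-> forall k, munn_idem F m n k ** v = 0.
Proof.
split=> [[w _ <-] k|v0]; first exact: id_act_e0.
by exists v => //; rewrite act1_e0 big1 ?subr0.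
Qed.

Lemma row_act_comp0 k (y : 'rV[F k]_(m k).+1) v : mm_comp0 v ->
  munn_row n y ** v = munn_row n (row_cons (row_tail y)) ** v.
Proof.
move=> /mm_comp0E v0; rewrite [in LHS](row_splitE y) munn_rowD linearDl.
by rewrite -row_act_id v0 linear0r add0r.
Qed.

Lemma comp0_fix v : mm_comp0 v -> act1 (munn_e0 F m n) v = v.
Proof. by move=> /mm_comp0E v0; rewrite act1_e0 big1 ?subr0. Qed.

Lemma id_act_col k l (j : 'I_(n l)) v :
  munn_idem F m n k ** (munn_col F m (lift ord0 j) ** v) = 0.
Proof.
rewrite -mm_actA; have [->|kl] := eqVneq k l.
  by rewrite munn_idemE munn_mul_row_col linear0l.
by rewrite munn_in_mul_neq // linear0l.
Qed.

Lemma e0_act_col l (j : 'I_(n l)) v :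
  act1 (munn_e0 F m n) (munn_col F m (lift ord0 j) ** v) =
  munn_col F m (lift ord0 j) ** v.
Proof. by apply/comp0_fix/mm_comp0E => k; exact: id_act_col. Qed.

Lemma comp_e0 l v : mm_comp l v -> act1 (munn_e0 F m n) v = 0.
Proof.
move=> /mm_compE <-; rewrite act1_e0 (bigD1 l) //= id_act_id.
rewrite big1 ?addr0 ?subrr //.
by move=> k kl; rewrite [in X in X ** _]munn_idemE row_act_neq.
Qed.

Lemma act_comp l (x : M) v : mm_comp l v ->
  x ** v = \sum_i munn_col F m i ** (munn_row n (row i (x l)) ** v).
Proof.
move=> /mm_compE lv; rewrite [in LHS](munn_sum_col_row x) linear_sumlz.
rewrite (bigD1 l) //= linear_sumlz [X in _ + X]big1 ?addr0; last first.
  move=> k kl; rewrite linear_sumlz big1 // => i _.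
  by rewrite mm_actA -lv row_act_neq // linear0r.
by apply: eq_bigr => i _; rewrite mm_actA.
Qed.

Section Kernel.
Variable a : forall k, 'I_(m k) -> M1.
Hypothesis ha : forall k, is_left_basis (@a k).

(** The a_ki span e_k M^1 e_0, so together they kill as much of V_0 as all the rows do, and by
    [munn_sum_col_row] every element of M acts through rows. *)
Lemma mm_kerE v : mm_ker a v <-> forall x : M, x ** v = 0.
Proof.
split=> [[v0 av] x|v0]; last first.
  have v00 : mm_comp0 v by apply/mm_comp0E => k.
  split=> // k i; have [/(_ i) [x _ ax] _] := ha k.
  rewrite /mm_alpha -ax !act1M comp0_fix // munn_eE act1_munn /act1 v0 addr0.
  by rewrite linearZr /= v0 scaler0.
rewrite (munn_sum_col_row x) linear_sumlz big1 // => k _.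
rewrite linear_sumlz big1 // => i _; rewrite mm_actA.
set y := row _ _; have [_ span] := ha k.
(* The row itself may lie outside e_k M^1 e_0, but e_k fixes it on the left and e_0 fixes v, so the
   product acts on v as the row does. *)
have [|c [+ _]] := span (munn_e F m n k * (0, munn_row n y) * munn_e0 F m n).
  by exists (0, munn_row n y).
move=> /(congr1 (fun x => act1 x v)).
rewrite !act1M comp0_fix // munn_eE !act1_munn id_act_row => ->.
rewrite act1_suml big1 ?linear0r // => j _.
by rewrite act1M; have := av k j; rewrite /mm_alpha => ->; rewrite act10.
Qed.

End Kernel.

Section Plus.
Variable b : forall k, 'I_(n k) -> M1.
Hypothesis hb : forall k, is_right_basis (@b k).

Lemma mm_plusD v w : mm_plus b v -> mm_plus b w -> mm_plus b (v + w).
Proof.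
move=> vP wP; rewrite -[w]opprK -[- w]sub0r; apply: mm_plusB => //.
by apply: mm_plusB => //; exact: mm_plus0.
Qed.

Lemma mm_plus_sum I (r : seq I) (P : pred I) (G : I -> V) :
  (forall i, P i -> mm_plus b (G i)) -> mm_plus b (\sum_(i <- r | P i) G i).
Proof.
move=> GP; elim/big_ind: _ => //; [exact: mm_plus0|exact: mm_plusD].
Qed.

Lemma mm_plus_beta l (j : 'I_(n l)) v :
  mm_comp l v -> mm_plus b (mm_beta b j v).
Proof.
(* As long as l' = l is unknown, j' and j have different types, so they are compared as natural
   numbers. *)
move=> vl; exists (fun l' j' => if (l' == l) && (j' == j :> nat) then v else 0).
split=> [l' j'|].
  have comp0 : mm_comp l' (0 : V) by apply/mm_compE; rewrite linear0r.
  by case: ifP => // /andP[/eqP e _]; rewrite e.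
rewrite (bigD1 l) //= (bigD1 j) //= !eqxx /= !big1 ?addr0 //.
  move=> l' /negPf ll; rewrite big1 // => j' _; rewrite ll; exact: act10.
move=> j' jj; rewrite ifF /=; first exact: act10.
by apply/negP => /eqP/val_inj; exact/eqP.
Qed.

Lemma mm_plus_act l (x : M1) v :
  mm_plus b (act1 (munn_e0 F m n * x * munn_e F m n l) v).
Proof.
have [_ span] := hb l.
have [|c [-> _]] := span (munn_e0 F m n * x * munn_e F m n l).
  by exists x.
rewrite act1_suml; apply: mm_plus_sum => j _; rewrite act1M.
by apply: mm_plus_beta; rewrite munnFE act1_munn; apply/mm_compE/id_act_row.
Qed.

(** A change of basis of e_0 M^1 e_k, from the b_j to the E_j0 with positive index. *)
Lemma mm_plusE v : mm_plus b v <->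
  exists w : forall l, 'I_(n l) -> V, (forall l j, mm_comp l (w l j)) /\
    v = \sum_l \sum_j munn_col F m (lift ord0 j) ** w l j.
Proof.
split=> [[w [wl ->]]|[w [wl ->]]]; last first.
  apply: mm_plus_sum => l _; apply: mm_plus_sum => j _.
  have := mm_plus_act l (0, munn_col F m (lift ord0 j)) (w l j).
  by rewrite !act1M munn_eE !act1_munn (mm_compE _ _).1 // e0_act_col.
have [x bE] : exists x : forall l, 'I_(n l) -> M1,
    forall l (j : 'I_(n l)), b j = munn_e0 F m n * x l j * munn_e F m n l.
  have B l (j : 'I_(n l)) : {x | b j = munn_e0 F m n * x * munn_e F m n l}.
    by apply: cid; have [/(_ j)[x _ <-] _] := hb l; exists x.
  by exists (fun l j => sval (B l j)) => l j; exact: svalP (B l j).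
(* With b_j = e_0 x e_l, the rows of x with positive index are the coordinates of b_j. The scalar
   part of x and its row 0 send V_l into V_l, which e_0 kills. *)
exists (fun l j' =>
  \sum_j munn_row n (row (lift ord0 j') ((x l j).2 l)) ** w l j).
split=> [l j'|].
  apply/mm_compE; rewrite linear_sumr; apply: eq_bigr => j _.
  exact: id_act_row.
apply: eq_bigr => l _; under [RHS]eq_bigr do rewrite linear_sumr.
rewrite exchange_big; apply: eq_bigr => j _ /=.
rewrite /mm_beta bE !act1M munn_eE act1_munn (mm_compE _ _).1 //.
rewrite [act1 (x l j) _]/act1 act1D (_ : act1 _ (_ *: _) = 0); last first.
  rewrite (@comp_e0 l) //; apply/mm_compE.
  by rewrite linearZr /= (mm_compE _ _).1.
rewrite add0r (act_comp _ (wl l j)) big_ord_recl act1D.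
rewrite (@comp_e0 l) ?add0r; last by apply/mm_compE; rewrite id_act_id.
by rewrite act1_sumr; apply: eq_bigr => j' _; rewrite e0_act_col.
Qed.

Lemma mm_plus_comp0 v : mm_plus b v -> mm_comp0 v.
Proof.
move=> /mm_plusE[w [_ ->]]; apply/mm_comp0E => k.
rewrite linear_sumr big1 // => l _; rewrite linear_sumr big1 // => j _.
exact: id_act_col.
Qed.

End Plus.

End OneModule.

Lemma munn_hom_comp0 (V W : munn_module F m n) (f : munn_hom V W) v :
  mm_comp0 v -> mm_comp0 (f v).
Proof. by move=> [u _ <-]; rewrite munn_hom_act1; exists (f u). Qed.

Lemma munn_hom_act (V W : munn_module F m n) (f : munn_hom V W) x v :
  f (x ** v) = x ** f v.
Proof. by rewrite -!act1_munn munn_hom_act1. Qed.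

Lemma munn_hom_linear (V W : munn_module F m n) (f : munn_hom V W) : linear f.
Proof. by case: f => f []. Qed.

Lemma hom_inverse (V W : munn_module F m n) (f : munn_hom V W) (g : W -> V) :
  cancel f g -> cancel g f -> is_munn_hom g.
Proof.
move=> fK gK; split=> [c u v|x v]; apply: (can_inj fK).
  by rewrite munn_hom_linear !gK.
by rewrite munn_hom_act !gK.
Qed.

End MunnModules.

(** * From representations to modules *)

Section RealizeModule.
Variables (K : fieldType) (s : nat) (F : 'I_s -> falgType K).
Variables (m n : 'I_s -> nat).
Variable X : rep F m n.
Local Notation M := (munn F m n).

Definition realize_sort : lmodType K :=
  (rep_plus X * rep_minus X *
   depfun (fun k => rscal (rep_sort X k) : lmodType K))%type.

Lemma realizeP (t u : realize_sort) :
  t.1.1 = u.1.1 -> t.1.2 = u.1.2 -> (forall k, t.2 k = u.2 k) -> t = u.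
Proof. by move: t u => [[p q] v] [[p' q'] v'] /= -> -> /depfunP->. Qed.

(** The intended action of [munn_row y], as [row_act] confirms: entry 0 is a scalar on X_k, the
    other entries act on X_- through [rep_talpha], and X_+ is killed. *)
Definition row_value k (y : 'rV[F k]_(m k).+1) (t : realize_sort) :
    rep_sort X k :=
  y 0 0 *: (t.2 k : rep_sort X k) + rep_talpha (row_tail y) t.1.2.

Lemma row_value_linearl k (t : realize_sort) :
  linear (fun y : 'rV[F k]_(m k).+1 => row_value y t).
Proof.
move=> c y z; rewrite /row_value !mxE scalerDl -scalerA scalerDr addrACA.
congr (_ + _); rewrite -rep_talpha_linl; congr (rep_talpha _ _).
by apply/rowP => j; rewrite !mxE.
Qed.

Lemma row_value_linearr k (y : 'rV[F k]_(m k).+1) :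
  linear (row_value y : realize_sort -> rscal (rep_sort X k)).
Proof.
move=> c t u; rewrite /row_value /= scalerDr.
have -> : y 0 0 *: (c *: t.2) k =
    (c%:A : F k) *: (y 0 0 *: (t.2 k : rep_sort X k)).
  by rewrite [(c *: t.2) k]rscalE !scalerA mulr_algr mulr_algl.
rewrite rep_talpha_linr.
pose A := y 0 0 *: (t.2 k : rep_sort X k).
pose B := rep_talpha (row_tail y) t.1.2.
pose C := y 0 0 *: (u.2 k : rep_sort X k).
pose D := rep_talpha (row_tail y) u.1.2.
(* The goal mixes the structures of [rscal (rep_sort X k)] and [rep_sort X k]; it is restated over
   F_k, where c acts as [c%:A]. *)
change (c%:A *: A + C + (c%:A *: B + D) = c%:A *: (A + B) + (C + D)).
by rewrite addrACA -scalerDr.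
Qed.

(* Row 0 of the block x_k maps into X_k and the other rows map through X_k into
   X_+: row i is (E_i0) mu (row i put in row 0), and E_i0 acts by beta. *)
Definition realize_act (x : M) (t : realize_sort) : realize_sort :=
  (\sum_k rep_tbeta X k [ffun j => row_value (row (lift ord0 j) (x k)) t], 0,
   fun k => row_value (row 0 (x k)) t).

Lemma realize_act_bilinear :
  bilinear_for (GRing.Scale.Law.clone _ _ *:%R _)
    (GRing.Scale.Law.clone _ _ *:%R _) realize_act.
Proof.
split=> [t c x y|x c t u]; apply: realizeP => //=.
- rewrite scaler_sumr -big_split; apply: eq_bigr => k _ /=.
  rewrite -linearP; congr (rep_tbeta X k _); apply/ffunP => j; rewrite !ffunE.
  rewrite rscalE -row_value_linearl; congr (row_value _ _).
  by apply/rowP => i; rewrite !mxE.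
- by rewrite scaler0 addr0.
- move=> k; apply: etrans (row_value_linearl t c%:A _ _).
  by congr (row_value _ _); apply/rowP => i; rewrite !mxE.
- rewrite scaler_sumr -big_split; apply: eq_bigr => k _ /=.
  rewrite -linearP; congr (rep_tbeta X k _); apply/ffunP => j; rewrite !ffunE.
  exact: row_value_linearr.
- by rewrite scaler0 addr0.
- by move=> k; exact: row_value_linearr.
Qed.

HB.instance Definition _ :=
  bilinear_isBilinear.Build K M realize_sort realize_sort *:%R *:%R
    realize_act realize_act_bilinear.

Lemma row_value_act k (y : 'rV[F k]_(m k).+1) (x : M) t :
  row_value y (realize_act x t) = y 0 0 *: row_value (row 0 (x k)) t.
Proof.
by rewrite /row_value /= (linear_fun0 (rep_talpha_linr (row_tail y))) addr0.
Qed.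

Lemma row_valueZ k (c : F k) (y : 'rV[F k]_(m k).+1) t :
  row_value (c *: y) t = c *: row_value y t.
Proof. exact: (GRing.scalable_linear (row_value_linearl t)). Qed.

(** Row i of xy is x_i0 times row 0 of y. On the other side, the result of an action has no X_-
    part, so only the entry x_i0 of row i of x acts on it. *)
Lemma realize_actA (x y : M) t :
  realize_act (munn_mul x y) t = realize_act x (realize_act y t).
Proof.
have rowE k (i : 'I_(n k).+1) : row i (munn_mul x y k) = x k i 0 *: row 0 (y k).
  apply/rowP => j; rewrite /munn_mul mulmx_mu !mxE big_ord1 !mxE.
  by [].
rewrite /realize_act; congr (_, _, _).
  apply: eq_bigr => k _; congr (rep_tbeta X k _); apply/ffunP => j.
  by rewrite !ffunE row_value_act rowE mxE row_valueZ.
by apply: depfunP => k; rewrite row_value_act rowE mxE row_valueZ.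
Qed.

Definition realize : munn_module F m n :=
  MunnModule (mm_act := realize_act) realize_actA.

Definition in_plus (p : rep_plus X) : realize := (p, 0, 0).
Definition in_minus (u : rep_minus X) : realize := (0, u, 0).
Definition in_comp k (v : rep_sort X k) : realize :=
  (0, 0, eqtype.dfwith
     (0 : depfun (fun k => rscal (rep_sort X k) : lmodType K)) v).

Lemma in_comp_eq k (v : rep_sort X k) : (in_comp v).2 k = v.
Proof. exact: dfwith_in. Qed.

Lemma in_comp_neq k l (v : rep_sort X k) : k != l -> (in_comp v).2 l = 0.
Proof. exact: dfwith_out. Qed.

Lemma row_value0 k (t : realize_sort) : row_value (0 : 'rV[F k]_(m k).+1) t = 0.
Proof. exact: linear_fun0 (row_value_linearl t). Qed.

Lemma row_act k (y : 'rV[F k]_(m k).+1) (t : realize) :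
  munn_row n y ** t = in_comp (row_value y t).
Proof.
have rowE (i : 'I_(n k).+1) : row i (munn_row n y k) = (i == 0)%:R *: y.
  rewrite [munn_row n y k]munn_in_eq row_mul; apply/rowP => j.
  by rewrite !mxE big_ord1 !mxE andbT.
have rowE0 l (i : 'I_(n l).+1) : k != l -> row i (munn_row n y l) = 0.
  move=> kl; rewrite [munn_row n y l]munn_in_neq //.
  by apply/rowP => j; rewrite !mxE.
apply: realizeP => [|//|l].
  rewrite /= big1 // => l _; have [<-|kl] := eqVneq k l.
    rewrite (_ : finfun _ = 0) ?linear0 //; apply/ffunP => j.
    by rewrite !ffunE rowE scale0r row_value0.
  rewrite (_ : finfun _ = 0) ?linear0 //; apply/ffunP => j.
  by rewrite !ffunE rowE0 // row_value0.
have [<-|kl] := eqVneq k l; first by rewrite in_comp_eq /= rowE eqxx scale1r.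
by rewrite in_comp_neq //= rowE0 // row_value0.
Qed.

Lemma row_value_delta k (t : realize_sort) :
  row_value (delta_mx 0 0 : 'rV[F k]_(m k).+1) t = t.2 k.
Proof.
rewrite /row_value mxE !eqxx scale1r (_ : row_tail _ = 0).
  by rewrite (linear_fun0 (rep_talpha_linl _)) addr0.
by apply/rowP => j; rewrite !mxE.
Qed.

Lemma id_act k (t : realize) :
  munn_idem F m n k ** t = in_comp (t.2 k : rep_sort X k).
Proof. by rewrite munn_idemE row_act row_value_delta. Qed.

Lemma col_act k (j : 'I_(n k)) (t : realize) :
  munn_col F m (lift ord0 j) ** t =
  in_plus (rep_tbeta X k [ffun j' => if j' == j then t.2 k else 0]).
Proof.
have rowE (i : 'I_(n k).+1) : row i (munn_col F m (lift ord0 j) k) =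
    (i == lift ord0 j)%:R *: delta_mx 0 0.
  rewrite [munn_col _ _ _ k]munn_in_eq; apply/rowP => j'.
  rewrite !mxE /=; case: (_ == lift _ _); first by rewrite mul1r.
  by rewrite mul0r.
have rowE0 l (i : 'I_(n l).+1) :
    k != l -> row i (munn_col F m (lift ord0 j) l) = 0.
  move=> kl; rewrite [munn_col _ _ _ l]munn_in_neq //.
  by apply/rowP => j'; rewrite !mxE.
apply: realizeP => [||l] //=.
  rewrite (bigD1 k) //= big1 ?addr0 => [|l lk].
    congr (rep_tbeta X k _); apply/ffunP => j'; rewrite !ffunE rowE.
    rewrite (inj_eq lift_inj); case: eqP => _.
      by rewrite scale1r row_value_delta.
    by rewrite scale0r row_value0.
  rewrite (_ : finfun _ = 0) ?linear0 //; apply/ffunP => j'.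
  by rewrite !ffunE rowE0 1?eq_sym // row_value0.
have [<-|kl] := eqVneq k l; last by rewrite rowE0 // row_value0.
by rewrite rowE scale0r row_value0.
Qed.

End RealizeModule.

(** * The realization functor, faithful and full modulo the ideal *)

Section RealizeHom.
Variables (K : fieldType) (s : nat) (F : 'I_s -> falgType K).
Variables (m n : 'I_s -> nat).

Section Hom.
Variables (X Y : rep F m n) (f : rep_hom X Y).

Definition realize_fun (t : realize X) : realize Y :=
  (rep_homp f t.1.1, rep_homm f t.1.2, fun k => rep_homk f (t.2 k)).

Lemma row_value_hom k (y : 'rV[F k]_(m k).+1) t :
  row_value y (realize_fun t) = rep_homk f (row_value y t).
Proof.
have [fkL _ _ fA _] := rep_homP f.
by rewrite /row_value fkL fA.
Qed.

Lemma realize_funP : is_munn_hom realize_fun.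
Proof.
have [fkL fmL fpL _ fB] := rep_homP f.
split=> [c t u|x t].
  by apply: realizeP => [||k]; [exact: fpL|exact: fmL|exact: fkL].
apply: realizeP => [||k].
- rewrite /= (linear_fun_sum _ _ _ fpL); apply: eq_bigr => k _.
  rewrite fB; congr (rep_tbeta Y k _); apply/ffunP => j.
  by rewrite !ffunE row_value_hom.
- exact: linear_fun0 fmL.
- by rewrite /= row_value_hom.
Qed.

Definition realize_hom : munn_hom (realize X) (realize Y) :=
  MunnHom realize_funP.

End Hom.

Lemma realize_hom_id (X : rep F m n) :
  realize_hom (rep_id X) = munn_id (realize X).
Proof. by apply: munn_hom_eq => t; exact: realizeP. Qed.

Lemma realize_hom_comp (X Y Z : rep F m n) (g : rep_hom Y Z) (f : rep_hom X Y) :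
  realize_hom (rep_comp g f) = munn_comp (realize_hom g) (realize_hom f).
Proof. by apply: munn_hom_eq => t; exact: realizeP. Qed.

Variables (a : forall k, 'I_(m k) -> munn1 F m n).
Variables (b : forall k, 'I_(n k) -> munn1 F m n).
Hypotheses (ha : forall k, is_left_basis (@a k)).
Hypotheses (hb : forall k, is_right_basis (@b k)).

Lemma realize_comp0 (X : rep F m n) (t : realize X) :
  mm_comp0 t <-> t.2 = 0.
Proof.
split=> [/mm_comp0E t0|t0].
  apply: depfunP => k; have := t0 k; rewrite id_act.
  move=> /(congr1 (fun u : realize X => u.2 k)).
  by rewrite in_comp_eq.
apply/mm_comp0E => k; rewrite id_act t0; apply: realizeP => // l.
by rewrite /=; case: dfwithP.
Qed.

Section PlusObject.
Variable X : rep F m n.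
Hypothesis Xsurj : forall v : rep_plus X,
  exists w : forall l, {ffun 'I_(n l) -> rscal (rep_sort X l)},
    v = \sum_l rep_tbeta X l (w l).
Hypothesis Xinj : forall v : rep_minus X,
  (forall k (i : 'I_(m k)), rep_alpha i v = 0) -> v = 0.

Lemma in_plus_linear : linear (@in_plus _ _ _ _ _ X).
Proof.
by move=> c u v; apply: realizeP => //= [|k]; rewrite ?scaler0 addr0.
Qed.

Lemma sum_col_act l (w : {ffun 'I_(n l) -> rscal (rep_sort X l)}) :
  \sum_j munn_col F m (lift ord0 j) ** in_comp (w j : rep_sort X l) =
  in_plus (rep_tbeta X l w).
Proof.
under eq_bigr do rewrite col_act in_comp_eq.
rewrite -(linear_fun_sum _ _ _ in_plus_linear).
rewrite -linear_sum; congr (in_plus (rep_tbeta X l _)); apply/ffunP => j.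
rewrite sum_ffunE (bigD1 j) //= ffunE eqxx big1 ?addr0 // => j' /negPf jj.
by rewrite ffunE eq_sym jj.
Qed.

Lemma realize_plus (t : realize X) : mm_plus b t <-> t = in_plus t.1.1.
Proof.
split=> [tP|->].
  apply: realizeP => //.
    have [w [_ ->]] := (mm_plusE hb t).1 tP.
    have minus_linear : linear (fun u : realize X => u.1.2) by [].
    rewrite (linear_fun_sum _ _ _ minus_linear) big1 // => l _.
    rewrite (linear_fun_sum _ _ _ minus_linear) big1 //.
  by move=> k; move: tP => /mm_plus_comp0/realize_comp0 ->.
have [w ->] := Xsurj t.1.1; rewrite (linear_fun_sum _ _ _ in_plus_linear).
apply/(mm_plusE hb); exists (fun l j => in_comp (w l j : rep_sort X l)).
split=> [l j|]; first by apply/mm_compE; rewrite id_act in_comp_eq.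
by apply: eq_bigr => l _; rewrite sum_col_act.
Qed.

Lemma realize_ker (t : realize X) : mm_ker a t <-> t = in_plus t.1.1.
Proof.
split=> [/(mm_kerE ha) t0|->].
  have t2 k : t.2 k = 0.
    have := t0 (munn_idem F m n k); rewrite id_act.
    move=> /(congr1 (fun u : realize X => u.2 k)).
    by rewrite in_comp_eq.
  apply: realizeP => //; apply: Xinj => k i.
  (* The entry 0 of this row is 0, so it acts as alpha_ki on the X_- part alone. *)
  pose y : 'rV[F k]_(m k).+1 := delta_mx 0 (lift ord0 i).
  have := t0 (munn_row n y); rewrite row_act.
  move=> /(congr1 (fun u : realize X => u.2 k)).
  rewrite in_comp_eq /row_value !mxE /= scale0r add0r /rep_alpha => ri.
  rewrite -[RHS]ri; congr (rep_talpha _ _).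
  by apply/rowP => j; rewrite !mxE (inj_eq lift_inj).
apply/(mm_kerE ha) => x.
have v0 k (y : 'rV[F k]_(m k).+1) : row_value y (in_plus t.1.1) = 0.
  by rewrite /row_value /= scaler0 add0r (linear_fun0 (rep_talpha_linr _)).
apply: realizeP => [||k] //=; last exact: v0.
rewrite big1 // => k _; rewrite (_ : finfun _ = 0) ?linear0 //.
by apply/ffunP => j; rewrite !ffunE v0.
Qed.

(** Each set is X_+: the first because the maps beta jointly cover X_+, the second because the maps
    alpha have no common kernel on X_-. *)
Lemma realize_plus_object :
  @mm_plus _ _ _ _ _ b (realize X) = @mm_ker _ _ _ _ _ a (realize X).
Proof.
apply: funext => t; apply: propext; apply: iff_trans (realize_plus t) _.
exact: iff_sym (realize_ker t).
Qed.

End PlusObject.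

Definition realize_ob (X : RepPlus F m n) : MunnModPlus a b :=
  exist _ (realize (sval X)) (realize_plus_object (svalP X).1 (svalP X).2).

Local Notation Quot := (quotient_category (munn_ideal a b)).

Definition realize_map (X Y : RepPlus F m n) (f : hom X Y) :
    qhom (munn_ideal a b) (realize_ob X) (realize_ob Y) :=
  \pi_{ideal_quot ideal_pred (munn_ideal a b) (realize_ob X) (realize_ob Y)}
    (realize_hom f : phom (realize_ob X) (realize_ob Y)).

Lemma realize_map1 (X : RepPlus F m n) :
  realize_map (idm X) = idm (realize_ob X : Quot).
Proof. by rewrite /realize_map /= realize_hom_id. Qed.

Lemma realize_mapM (X Y Z : RepPlus F m n) (g : hom Y Z) (f : hom X Y) :
  realize_map (comp g f) =
  comp (realize_map g : hom (realize_ob Y : Quot) (realize_ob Z))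
    (realize_map f).
Proof. by rewrite /realize_map /= realize_hom_comp qcompE. Qed.

Definition realize_functor : functor (RepPlus F m n) Quot :=
  @Functor _ Quot _ _ realize_map1 realize_mapM.

Lemma hom_in_comp (X Y : rep F m n) (phi : munn_hom (realize X) (realize Y)) k
    (v : rep_sort X k) :
  phi (in_comp v) = in_comp ((phi (in_comp v)).2 k : rep_sort Y k).
Proof. by rewrite -id_act -munn_hom_act id_act in_comp_eq. Qed.

Lemma hom_in_plus (X Y : RepPlus F m n)
    (phi : munn_hom (realize (sval X)) (realize (sval Y))) p :
  phi (in_plus p) = in_plus (phi (in_plus p)).1.1.
Proof.
have [Xs _] := svalP X; have [Ys _] := svalP Y.
by apply/(realize_plus Ys)/munn_hom_plus/(realize_plus Xs).
Qed.

Lemma realize_split (X : rep F m n) (t : realize X) :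
  t.2 = 0 -> t = in_plus t.1.1 + in_minus t.1.2.
Proof.
by move=> t2; apply: realizeP => [||k] /=; rewrite ?t2 ?addr0 ?add0r.
Qed.

Lemma in_compD (X : rep F m n) k (v w : rep_sort X k) :
  in_comp (v + w) = in_comp v + in_comp w.
Proof.
apply: realizeP => [||l]; [by rewrite /= addr0..|].
have -> : (in_comp v + in_comp w).2 l = (in_comp v).2 l + (in_comp w).2 l by [].
have [<-|kl] := eqVneq k l; first by rewrite !in_comp_eq.
by rewrite !in_comp_neq // addr0.
Qed.

(** The three clauses defining the ideal are applied to f - g on X_k, X_- and X_+. On X_- the
    difference lands in Y_+, so its component into Y_- vanishes. *)
Lemma realize_faithful (X Y : RepPlus F m n) (f g : hom X Y) :
  realize_map f = realize_map g -> f = g.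
Proof.
move=> /qhom_eqP /asboolP[fg1 fg2 fg3]; apply: rep_hom_eq => [k v|u|p].
- have := fg1 k (in_comp v); rewrite mm_compE id_act in_comp_eq => /(_ erefl).
  move=> /(congr1 (fun t : realize (sval Y) => t.2 k)) /subr0_eq.
  by rewrite /= !dfwith_in.
- have := fg3 (in_minus u); rewrite realize_comp0 => /(_ erefl).
  have [Ys _] := svalP Y.
  move=> /(realize_plus Ys)/(congr1 (fun t : realize (sval Y) => t.1.2)).
  exact: subr0_eq.
- have [Xs _] := svalP X.
  have := fg2 (in_plus p); rewrite (realize_plus Xs) => /(_ erefl).
  by move=> /(congr1 (fun t : realize (sval Y) => t.1.1))/subr0_eq.
Qed.

Lemma row_value_cons (X : rep F m n) k (r : 'rV[F k]_(m k)) (t : realize X) :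
  row_value (row_cons r) t = rep_talpha r t.1.2.
Proof. by rewrite /row_value row_cons0 scale0r add0r row_consK. Qed.

Section Full.
Variables (X Y : RepPlus F m n).
Variable phi : munn_hom (realize (sval X)) (realize (sval Y)).

Let fk k (v : rep_sort (sval X) k) : rep_sort (sval Y) k :=
  (phi (in_comp v)).2 k.
Let fm (u : rep_minus (sval X)) : rep_minus (sval Y) := (phi (in_minus u)).1.2.
Let fp (p : rep_plus (sval X)) : rep_plus (sval Y) := (phi (in_plus p)).1.1.

Lemma hom_components : is_rep_hom fk fm fp.
Proof.
have phiL := munn_hom_linear phi.
have phiD t u : phi (t + u) = phi t + phi u.
  by have := phiL 1 t u; rewrite !scale1r.
split=> [k c u v|c u v|c u v|k r u|k w].
(* F_k-linearity follows from commuting with M, since c in F_k acts on X_k as the element c e_k. *)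
- rewrite /fk; have -> : in_comp (c *: u + v) =
      munn_row n (c *: (delta_mx 0 0 : 'rV[F k]_(m k).+1)) ** in_comp u +
      in_comp v.
    by rewrite row_act row_valueZ row_value_delta in_comp_eq in_compD.
  rewrite phiD munn_hom_act row_act row_valueZ row_value_delta.
  have snd_add (t t' : realize (sval Y)) : (t + t').2 k = t.2 k + t'.2 k by [].
  by rewrite snd_add in_comp_eq.
- rewrite /fm; have -> : in_minus (c *: u + v) =
      c *: in_minus u + in_minus v :> realize (sval X).
    by apply: realizeP => //= [|l]; rewrite ?scaler0 addr0.
  by rewrite phiL.
- by rewrite /fp in_plus_linear phiL.
- have := munn_hom_act phi (munn_row n (row_cons r)) (in_minus u).
  rewrite !row_act !row_value_cons /=.
  move=> /(congr1 (fun t : realize (sval Y) => t.2 k)).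
  by rewrite in_comp_eq.
(* Every value of [rep_tbeta] is a sum of elements E_j0 applied to vectors of X_k, so phi is
   determined on it by its components on X_k. *)
- suff : phi (in_plus (rep_tbeta (sval X) k w)) =
      in_plus (rep_tbeta (sval Y) k [ffun j => fk (w j)]) by rewrite /fp => ->.
  rewrite -!sum_col_act (linear_fun_sum _ _ _ phiL); apply: eq_bigr => j _.
  by rewrite munn_hom_act hom_in_comp ffunE.
Qed.

Lemma realize_full : exists f : hom X Y, realize_map f =
  \pi_{ideal_quot ideal_pred (munn_ideal a b) (realize_ob X) (realize_ob Y)}
    (phi : phom (realize_ob X) (realize_ob Y)).
Proof.
exists (RepHom hom_components); apply/qhom_eqP/asboolP; set f := RepHom _.
(* The diagonal blocks of phi cancel in g, which leaves only a map from X_- to Y_+. *)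
pose g : munn_hom (realize (sval X)) (realize (sval Y)) := realize_hom f - phi.
have gE t : g t = realize_hom f t - phi t by [].
have gD t u : g (t + u) = g t + g u.
  by have := munn_hom_linear g 1 t u; rewrite !scale1r.
have [Xs _] := svalP X; have [Ys _] := svalP Y.
have g_plus p : g (in_plus p) = 0.
  by rewrite gE hom_in_plus [X in _ - X]hom_in_plus subrr.
change (in_munn_ideal b g); split=> [k t|t|t t0].
- move=> /mm_compE <-; rewrite gE id_act hom_in_comp [X in _ - X]hom_in_comp.
  by rewrite /= !dfwith_in subrr.
- by move=> /(realize_plus Xs) ->.
- have /realize_comp0 g0 := munn_hom_comp0 g t0.
  apply/(realize_plus Ys); apply: realizeP => [//||k]; last by rewrite g0.
  move: t0; rewrite realize_comp0 => /realize_split ->.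
  by rewrite gD g_plus add0r gE /= subrr.
Qed.

End Full.

End RealizeHom.

(** * From modules to representations *)

Section SubmoduleType.
Variables (R : pzRingType) (V : lmodType R) (S : submodClosed V).

Definition submodule_type : Type := {v : V | v \in S}.
HB.instance Definition _ := Choice.on submodule_type.
HB.instance Definition _ := SubType.on submodule_type.
HB.instance Definition _ := [SubChoice_isSubLmodule of submodule_type by <:].

End SubmoduleType.

Section Component.
Variables (K : fieldType) (s : nat) (F : 'I_s -> falgType K).
Variables (m n : 'I_s -> nat) (V : munn_module F m n) (k : 'I_s).

Definition comp_pred : {pred V} := fun v => munn_idem F m n k ** v == v.

Lemma comp_pred_closed : zmod_closed comp_pred.
Proof.
split=> [|u v /eqP uk /eqP vk]; rewrite unfold_in ?linear0r //.
by rewrite linearBr uk vk.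
Qed.

HB.instance Definition _ :=
  GRing.isZmodClosed.Build V comp_pred comp_pred_closed.

Definition component : Type := {v : V | v \in comp_pred}.
HB.instance Definition _ := Choice.on component.
HB.instance Definition _ := SubType.on component.
HB.instance Definition _ := [SubChoice_isSubZmodule of component by <:].

Lemma row_act_in_comp (y : 'rV[F k]_(m k).+1) (v : V) :
  munn_row n y ** v \in comp_pred.
Proof. by apply/eqP; exact: id_act_row. Qed.

Definition row_component (y : 'rV[F k]_(m k).+1) (v : V) : component :=
  exist _ (munn_row n y ** v) (row_act_in_comp y v).

Lemma componentK (v : component) : munn_idem F m n k ** val v = val v.
Proof. exact/eqP/(valP v). Qed.

(** The scalars come from F_k = e_k M^1 e_k: f acts on V_k as the element f e_k. *)
Definition comp_scale (f : F k) (v : component) : component :=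
  row_component (f *: delta_mx 0 0) (val v).

Lemma comp_scaleA f g v : comp_scale f (comp_scale g v) = comp_scale (f * g) v.
Proof.
apply: val_inj.
by rewrite /= -mm_actA munn_mul_row_row !mxE !eqxx mulr1 scalerA.
Qed.
Lemma comp_scale1 : left_id 1 comp_scale.
Proof.
by move=> v; apply: val_inj; rewrite /= scale1r -munn_idemE componentK.
Qed.
Lemma comp_scaleDr : right_distributive comp_scale +%R.
Proof. by move=> f u v; apply: val_inj; rewrite /= linearDr. Qed.
Lemma comp_scaleDl v : {morph comp_scale^~ v : f g / f + g}.
Proof.
by move=> f g; apply: val_inj; rewrite /= scalerDl munn_rowD linearDl.
Qed.

HB.instance Definition _ :=
  GRing.Zmodule_isLmodule.Build (F k) component
    comp_scaleA comp_scale1 comp_scaleDr comp_scaleDl.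

Lemma comp_scaleE (f : F k) (v : component) :
  val (f *: v) = munn_row n (f *: delta_mx 0 0) ** val v.
Proof. by []. Qed.

(** Reconciles the two K-structures on V_k, the one restricted from F_k and the one inherited from
    V: c e_k acts on V_k as c. *)
Lemma comp_rscaleE (c : K) (v : component) :
  val ((c%:A : F k) *: v) = c *: val v.
Proof. by rewrite comp_scaleE munn_rowZ linearZl /= -munn_idemE componentK. Qed.

End Component.

Arguments comp_pred {K s F m n} V k.

(** * Modules of M-Mod^+ come from representations; the square of the ideal *)

Section Dense.
Variables (K : fieldType) (s : nat) (F : 'I_s -> falgType K).
Variables (m n : 'I_s -> nat).
Local Notation M := (munn F m n).
Variables (a : forall k, 'I_(m k) -> munn1 F m n).
Variables (b : forall k, 'I_(n k) -> munn1 F m n).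
Hypotheses (ha : forall k, is_left_basis (@a k)).
Hypotheses (hb : forall k, is_right_basis (@b k)).

Section Predicates.
Variables (V : munn_module F m n) (p : {linear V -> V}).

(** By [mm_kerE] this is the common kernel of the alpha_ki, hence V_+ for a module of M-Mod^+. It
    serves as the plus part of the representation. *)
Definition annihilated : {pred V} := fun v => `[< forall x : M, x ** v = 0 >].

(** With p a retraction onto the part killed by M, this is the complement V_- of that part in
    V_0. *)
Definition minus_pred : {pred V} := fun v => `[< mm_comp0 v /\ p v = 0 >].

Lemma annihilated_closed : submod_closed annihilated.
Proof.
split=> [|c u v /asboolP u0 /asboolP v0]; apply/asboolP => x.
  exact: linear0r.
by rewrite linearDr linearZr /= u0 v0 scaler0 addr0.
Qed.

Lemma minus_pred_closed : submod_closed minus_pred.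
Proof.
split=> [|c u v /asboolP[u0 pu] /asboolP[v0 pv]]; apply/asboolP.
  by split; [apply/mm_comp0E => k; rewrite linear0r | rewrite linear0].
split; last by rewrite linearP pu pv scaler0 addr0.
move: u0 v0; rewrite !mm_comp0E => u0 v0 k.
by rewrite linearDr linearZr /= u0 v0 scaler0 addr0.
Qed.

HB.instance Definition _ := GRing.isSubmodClosed.Build K V annihilated
  (GRing.submod_closed_semi annihilated_closed).
HB.instance Definition _ := GRing.isSubmodClosed.Build K V minus_pred
  (GRing.submod_closed_semi minus_pred_closed).

End Predicates.

Arguments annihilated : clear implicits.

Section Object.
Variable V : munn_module F m n.
Hypothesis hV : @mm_plus _ _ _ _ _ b V = @mm_ker _ _ _ _ _ a V.
Variable p : {linear V -> V}.
Hypothesis p_plus : forall v, p v \in annihilated V.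
Hypothesis p_id : forall v, v \in annihilated V -> p v = v.

Definition obj_plus : lmodType K :=
  submodule_type (annihilated V : submodClosed V).
Definition obj_minus : lmodType K :=
  submodule_type (minus_pred p : submodClosed V).

Definition obj_talpha k (r : 'rV[F k]_(m k)) (u : obj_minus) : component V k :=
  row_component (row_cons r) (val u).

Lemma obj_talpha_linl k u :
  linear (fun r : 'rV[F k]_(m k) => obj_talpha r u).
Proof.
move=> c r z; apply: val_inj; rewrite /= row_cons_linear munn_rowD linearDl.
congr (_ + _); rewrite -mm_actA munn_mul_row_row !mxE !eqxx mulr1.
by [].
Qed.

Lemma obj_talpha_linr k (r : 'rV[F k]_(m k)) :
  linear (obj_talpha r : obj_minus -> rscal (component V k)).
Proof.
move=> c u v; apply: val_inj; apply: etrans (linearP _ c (val u) (val v)) _.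
exact: esym (congr1 (fun x => x + _) (comp_rscaleE c (obj_talpha r u))).
Qed.

Lemma col_annihilated k (j : 'I_(n k)) (v : V) :
  munn_col F m (lift ord0 j) ** v \in annihilated V.
Proof.
by apply/asboolP => x; rewrite -mm_actA munn_mul_col_lift linear0l.
Qed.

Lemma obj_tbeta_subproof k (w : {ffun 'I_(n k) -> rscal (component V k)}) :
  \sum_j munn_col F m (lift ord0 j) ** val (w j : component V k)
    \in annihilated V.
Proof. by apply: rpred_sum => j _; exact: col_annihilated. Qed.

Definition obj_tbeta k (w : {ffun 'I_(n k) -> rscal (component V k)}) :
    obj_plus :=
  exist (fun v => v \in annihilated V) _ (obj_tbeta_subproof w).

Lemma obj_tbeta_linear k : linear (@obj_tbeta k).
Proof.
move=> c w z; apply: val_inj; rewrite /= scaler_sumr -big_split.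
apply: eq_bigr => j _; rewrite !ffunE.
apply: etrans (linearPr _ _ c _ _); congr (_ ** _).
by rewrite -comp_rscaleE.
Qed.

HB.instance Definition _ k := GRing.isLinear.Build K _ _ _ (@obj_tbeta k)
  (@obj_tbeta_linear k).

Definition obj_rep : rep F m n :=
  Rep (rep_sort := fun k => component V k : lmodType (F k))
    obj_talpha_linl obj_talpha_linr (fun k => @obj_tbeta k : {linear _ -> _}).

Lemma minusP (u : obj_minus) : mm_comp0 (val u) /\ p (val u) = 0.
Proof. exact/asboolP/(valP u). Qed.

Lemma plusP (q : obj_plus) x : x ** val q = 0.
Proof. by move: x; exact/asboolP/(valP q). Qed.

Lemma annihilated_plus (v : V) : v \in annihilated V -> mm_plus b v.
Proof. by move=> /asboolP v0; rewrite hV; apply/(mm_kerE ha). Qed.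

(** Here the condition defining M-Mod^+ is used: what M kills belongs to V_+, so it is a sum of
    vectors E_j0 w with w in some V_l. *)
Lemma obj_rep_surj (q : rep_plus obj_rep) :
  exists w : forall l, {ffun 'I_(n l) -> rscal (rep_sort obj_rep l)},
    q = \sum_l rep_tbeta obj_rep l (w l).
Proof.
have [w [wl qw]] := (mm_plusE hb _).1 (annihilated_plus (valP (q : obj_plus))).
have wP l (j : 'I_(n l)) : w l j \in comp_pred V l by apply/eqP/mm_compE.
pose w' l (j : 'I_(n l)) : component V l :=
  exist (fun v => v \in comp_pred V l) (w l j) (wP l j).
exists (fun l => [ffun j => w' l j]).
apply: val_inj; rewrite qw raddf_sum; apply: eq_bigr => l _ /=.
by apply: eq_bigr => j _; rewrite ffunE.
Qed.

Lemma obj_rep_inj (u : rep_minus obj_rep) :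
  (forall k (i : 'I_(m k)), rep_alpha i u = 0) -> u = 0.
Proof.
move=> u0; have [uc pu] := minusP u; apply: val_inj => /=.
(* It suffices that M kills u, for then p fixes u, whereas p vanishes on V_-. *)
rewrite -pu p_id //; apply/asboolP => x.
rewrite (munn_sum_col_row x) linear_sumlz big1 // => k _.
rewrite linear_sumlz big1 // => i _; rewrite mm_actA row_act_comp0 //.
set r := row_tail _; suff : obj_talpha r u = 0.
  by move=> /(congr1 val) /= ->; rewrite linear0r.
rewrite (row_sum_delta r) (linear_fun_sum _ _ _ (@obj_talpha_linl k u)).
rewrite big1 // => j _; rewrite (GRing.scalable_linear (@obj_talpha_linl k u)).
by have := u0 k j; rewrite /rep_alpha /= => ->; rewrite scaler0.
Qed.

Lemma val_row_value k (y : 'rV[F k]_(m k).+1) (t : realize obj_rep) :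
  val (row_value y t : component V k) =
  munn_row n y ** (val (t.1.2 : obj_minus) + val (t.2 k : component V k)).
Proof.
have [uc _] := minusP t.1.2.
rewrite [RHS]linearDr (row_act_comp0 _ uc) addrC.
apply: etrans (raddfD val _ _) _; congr (_ + _).
by rewrite -[in RHS](componentK (t.2 k)) row_act_id.
Qed.

Definition obj_fun (t : realize obj_rep) : V :=
  val (t.1.1 : obj_plus) + val (t.1.2 : obj_minus) +
  \sum_k val (t.2 k : component V k).

Lemma obj_funP : is_munn_hom obj_fun.
Proof.
split=> [c t u|x t].
  rewrite /obj_fun !scalerDr scaler_sumr [RHS]addrACA [X in _ = X + _]addrACA.
  rewrite -big_split /=.
  congr (_ + _); apply: eq_bigr => k _ /=.
  by rewrite -comp_rscaleE.
(* M kills the plus part, so x acts on [obj_fun t] as on z. Rows map z into V_k as in the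
   realization; splitting off row 0 separates the V_k part of the result from its plus part. *)
pose z := val (t.1.2 : obj_minus) + \sum_l val (t.2 l : component V l).
have row_z k (y : 'rV[F k]_(m k).+1) :
    munn_row n y ** z = val (row_value y t : component V k).
  rewrite val_row_value /z !linearDr linear_sumr (bigD1 k) //= big1 ?addr0 //.
  by move=> l lk; rewrite -(componentK (t.2 l)) row_act_neq // eq_sym.
have -> : obj_fun t = val (t.1.1 : obj_plus) + z by rewrite /obj_fun -addrA.
rewrite linearDr plusP add0r [in RHS](munn_sum_col_row x) linear_sumlz.
have -> : obj_fun (mm_act (realize obj_rep) x t) =
    \sum_k val (obj_tbeta [ffun j => row_value (row (lift ord0 j) (x k)) t]) +
    \sum_k val (row_value (row 0 (x k)) t : component V k).
  rewrite /obj_fun [val _ + val _]addr0; congr (_ + _).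
  exact: (raddf_sum (val : obj_plus -> V)).
rewrite -big_split; apply: eq_bigr => k _ /=.
rewrite linear_sumlz big_ord_recl addrC mm_actA id_act_row row_z; congr (_ + _).
by apply: eq_bigr => j _; rewrite ffunE mm_actA row_z.
Qed.

Definition obj_hom : munn_hom (realize obj_rep) V := MunnHom obj_funP.

(** The vector e_0 v is split by p, and e_k v goes to V_k. The default 0 of [insubd] is never
    returned, since v0 - p v0 always lies in V_-; see [obj_inv_minus]. *)
Definition obj_inv (v : V) : realize obj_rep :=
  let v0 := act1 (munn_e0 F m n) v in
  (exist (fun w => w \in annihilated V) (p v0) (p_plus v0) : obj_plus,
   insubd (0 : obj_minus) (v0 - p v0),
   fun k => row_component (delta_mx 0 0) v : component V k).

Lemma annihilated_comp0 (v : V) : v \in annihilated V -> mm_comp0 v.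
Proof. by move=> /asboolP v0; apply/mm_comp0E => k; exact: v0. Qed.

Lemma obj_inv_minus (v : V) : let v0 := act1 (munn_e0 F m n) v in
  val (insubd (0 : obj_minus) (v0 - p v0)) = v0 - p v0.
Proof.
move=> v0; rewrite insubdK //; apply/asboolP; split; last first.
  by rewrite linearB /= [p (p _)]p_id ?subrr.
have /mm_comp0E pv0 := annihilated_comp0 (p_plus v0).
by apply/mm_comp0E => k; rewrite linearBr pv0 subr0; exact: id_act_e0.
Qed.

Lemma obj_invK : cancel obj_inv obj_hom.
Proof.
move=> v; rewrite /= /obj_fun obj_inv_minus /= [p _ + _]addrC subrK act1_e0.
by under [X in _ - X]eq_bigr do rewrite munn_idemE; rewrite subrK.
Qed.

Lemma obj_homK : cancel obj_hom obj_inv.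
Proof.
move=> t; set q := t.1.1; set u := t.1.2.
have e0E : act1 (munn_e0 F m n) (obj_fun t) =
    val (q : obj_plus) + val (u : obj_minus).
  rewrite /obj_fun !act1D act1_sumr big1 => [|k _].
    rewrite addr0 !comp0_fix //; first by have [] := minusP u.
    exact: annihilated_comp0 (valP (q : obj_plus)).
  by apply: (@comp_e0 _ _ _ _ _ _ k); apply/mm_compE; exact: componentK.
have pE : p (act1 (munn_e0 F m n) (obj_fun t)) = val (q : obj_plus).
  by rewrite e0E linearD /= (minusP u).2 addr0 p_id // (valP (q : obj_plus)).
apply: realizeP => [||k]; apply: val_inj => //=.
- by rewrite obj_inv_minus pE e0E addrC addKr.
- rewrite -munn_idemE linearDr linearDr (plusP _ _) add0r.
  have [/mm_comp0E -> _] := minusP u; rewrite add0r linear_sumr (bigD1 k) //=.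
  rewrite componentK big1 ?addr0 // => l lk.
  by rewrite -(componentK (t.2 l)) munn_idemE row_act_neq // eq_sym.
Qed.

End Object.

Lemma plus_module_iso (V : munn_module F m n) :
  @mm_plus _ _ _ _ _ b V = @mm_ker _ _ _ _ _ a V ->
  exists (X : RepPlus F m n) (f : munn_hom (realize (sval X)) V)
    (g : munn_hom V (realize (sval X))), cancel f g /\ cancel g f.
Proof.
move=> hV.
have [q [qL qS qid]] := @exists_linear_retraction K V
  (fun v => v \in annihilated V)
  (rpred0 _) (fun c u v uS vS => rpredD (rpredZ c uS) vS).
pose p : {linear V -> V} := HB.pack_for {linear V -> V} q
  (GRing.isLinear.Build _ _ _ _ q qL).
have p_plus v : p v \in annihilated V by exact: qS.
have p_id v : v \in annihilated V -> p v = v by exact: qid.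
pose X : RepPlus F m n := exist _ (obj_rep p)
  (conj (obj_rep_surj hV (p := p)) (obj_rep_inj p_id)).
have fK := obj_homK p_plus p_id; have gK := obj_invK p_plus p_id.
by exists X, (obj_hom p), (MunnHom (hom_inverse fK gK)).
Qed.

Lemma realize_dense (V : quotient_category (munn_ideal a b)) :
  exists X, isomorphic (realize_functor ha hb X) V.
Proof.
have [X [f [g [fK gK]]]] := plus_module_iso (svalP V).
exists X.
pose I := munn_ideal a b.
exists (\pi_{ideal_quot ideal_pred I (realize_ob ha hb X) V}
    (f : phom (realize_ob ha hb X) V)).
exists (\pi_{ideal_quot ideal_pred I V (realize_ob ha hb X)}
    (g : phom V (realize_ob ha hb X))).
rewrite /= !qcompE; split; congr (\pi _); exact: munn_hom_eq.
Qed.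

(** In each product g h, the factor h kills every V_k and sends V_0 into V_+, on which g
    vanishes. *)
Lemma munn_ideal_square (V W : MunnModPlus a b) (f : phom V W) :
  ideal_mul (munn_ideal a b) (munn_ideal a b) f -> f = 0.
Proof.
move=> [r [Z [g [h [gh ->]]]]]; rewrite big1 // => i _.
have [/asboolP[g1 g2 g3] /asboolP[h1 h2 h3]] := gh i.
apply: munn_hom_eq => v /=.
have e0v : mm_comp0 (act1 (munn_e0 F m n) v) by exists v.
have hL : linear (h i) := munn_hom_linear (h i).
have -> : v = act1 (munn_e0 F m n) v + \sum_k munn_idem F m n k ** v.
  by rewrite act1_e0 subrK.
have hD u w : h i (u + w) = h i u + h i w.
  by have := hL 1 u w; rewrite !scale1r.
rewrite hD (linear_fun_sum _ _ _ hL) [X in _ + X]big1 => [|k _]; last first.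
  by apply: (h1 k); apply/mm_compE; exact: id_act_id.
by rewrite addr0; apply/g2/h3.
Qed.

End Dense.

Theorem theorem2p1 (K : fieldType) (s : nat) (F : 'I_s -> falgType K)
    (hF : forall k, GRing.field_axiom (F k))
    (m n : 'I_s -> nat) (hmn : forall k, (m k, n k) <> (0%N, 0%N))
    (a : forall k, 'I_(m k) -> munn1 F m n)
    (ha : forall k, is_left_basis (a k))
    (b : forall k, 'I_(n k) -> munn1 F m n)
    (hb : forall k, is_right_basis (b k)) :
  equivalent (quotient_category (munn_ideal a b)) (RepPlus F m n) /\
  (forall (V W : MunnModPlus a b) (f : phom V W),
     ideal_mul (munn_ideal a b) (munn_ideal a b) f -> f = 0).
Proof.
split; last exact: munn_ideal_square.
apply: equivalent_sym.
apply: (fully_faithful_dense_equivalent (F := realize_functor ha hb)).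
- move=> X Y g; have [f fE] := realize_full ha hb (repr g); exists f.
  by rewrite [LHS]fE reprK.
- by move=> X Y f g; exact: realize_faithful.
- exact: realize_dense.
Qed.
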